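(* Let $\mathbf{C}$ be a coalgebra over $\Bbbk$. Then the maps $F^n:\mathsf{G}^n[\mathbf{C}^\otimes]\to\mathsf{C}^n[\mathbf{C}]$, $F^n\psi=\psi\ast\mathbb{I}^{\otimes n}\ast\psi^{-1}$, $n\in\mathbb{N}_0$, are group anti-homomorphisms that define: (i) a natural transformation of the cosimplicial objects $[n+1]\mapsto\mathsf{G}^n[\mathbf{C}^\otimes]$ and $[n+1]\mapsto\mathsf{C}^n[\mathbf{C}]$ (i.e. they commute with all cofaces and codegeneracies), and (ii) a morphism of cochain quasicomplexes $(\mathsf{G}^\bullet[\mathbf{C}^\otimes],d)\to(\mathsf{C}^\bullet[\mathbf{C}],\partial)$ in $\mathrm{Grp}_{\ast q}$.
   Context: $\Bbbk$ is $\mathbb{R}$ or $\mathbb{C}$. The quasicomplex $\mathsf{C}^\bullet$: for a vector space $\mathbf{V}$ with tensor algebra $\mathbf{V}^\otimes$ (product $m_\otimes$, identity map $\mathbb{I}$), $\mathsf{C}^n[\mathbf{V}]$ is the group of linear automorphisms of $(\mathbf{V}^\otimes)^{\otimes n}$ mapping each $\mathbf{V}^{\otimes R}=\mathbf{V}^{\otimes r_1}\otimes\cdots\otimes\mathbf{V}^{\otimes r_n}$, $R=(r_1,\dots,r_n)\in\mathbb{N}_0^n$, onto itself ($\mathsf{C}^0=\Bbbk^\times$). Let $m_i^n$ ($1\le i\le n$) be the map multiplying the $i$-th and $(i+1)$-th of $n+1$ factors, and $\eta_i^n$ ($0\le i\le n$) the map inserting $1$ after the $i$-th of $n$ factors.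 Cofaces: $\delta_i^n\psi$ is the unique element of $\mathsf{C}^{n+1}[\mathbf{V}]$ with $m_i^n\delta_i^n\psi=\psi m_i^n$ for $1\le i\le n$; $\delta_0^n\psi=\mathbb{I}\otimes\psi$, $\delta_{n+1}^n\psi=\psi\otimes\mathbb{I}$ (for $n=0$ both are multiplication by the scalar $\psi$). Codegeneracies: $\sigma_i^n\psi$ is the unique element of $\mathsf{C}^n[\mathbf{V}]$ with $\eta_i^n\sigma_i^n\psi=\psi\eta_i^n$. The coboundary is $\partial\psi=\big(\overset{\rightarrow}{\prod}_{i\ odd}\delta_i\psi\big)\big(\overset{\leftarrow}{\prod}_{i\ even}\delta_i\psi\big)^{-1}$, $0\le i\le n+1$, where $\overset{\rightarrow}{\prod}$ (resp. $\overset{\leftarrow}{\prod}$) is the product with indices increasing (resp. decreasing) from left to right. The quasicomplex $\mathsf{G}^\bullet$: for a bialgebra $\mathbf{A}$ with structure $(m,\eta,\Delta,\varepsilon)$, $\mathsf{G}^n[\mathbf{A}]$ is the group of invertible elements of $Lin[\mathbf{A}^{\otimes n},\Bbbk]$ under the convolution product $\psi\ast\varphi=(\psi\otimes\varphi)\Delta^{(n)}$, with $\Delta^{(n)}$ the usual coproduct on $\mathbf{A}^{\otimes n}$ and unit $\varepsilon^{\otimes n}$. With $m_i^n:\mathbf{A}^{\otimes n+1}\to\mathbf{A}^{\otimes n}$ ($1\le i\le n$) the map applying $m$ to the $i$-th and $(i+1)$-th of $n+1$ factors (and the identity to the others), and $\eta_i^n:\mathbf{A}^{\otimes n}\to\mathbf{A}^{\otimes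 n+1}$ ($0\le i\le n$) the map inserting the unit $\eta(1)$ of $\mathbf{A}$ after the $i$-th of $n$ factors, cofaces are $d_0^n\psi=\varepsilon\otimes\psi$, $d_i^n\psi=\psi\,m_i^n$ ($1\le i\le n$), $d_{n+1}^n\psi=\psi\otimes\varepsilon$, codegeneracies $s_i^n\psi=\psi\,\eta_i^n$, and coboundary $d\psi=\big(\overset{\rightarrow}{\prod}_{i\ even}d_i\psi\big)^{-1}\ast\big(\overset{\leftarrow}{\prod}_{i\ odd}d_i\psi\big)$. For a coalgebra $\mathbf{C}$, $\mathbf{C}^\otimes$ is the bialgebra whose coproduct and counit are the algebra-map extensions of those of $\mathbf{C}$ (so $\Delta(\mathbf{C})\subset\mathbf{C}\otimes\mathbf{C}$). For $\psi\in\mathsf{G}^n[\mathbf{C}^\otimes]$, $\psi\ast\mathbb{I}^{\otimes n}\ast\psi^{-1}=(\psi\otimes\mathbb{I}^{\otimes n}\otimes\psi^{-1})(\mathbb{I}^{\otimes n}\otimes\Delta^{(n)})\Delta^{(n)}$, an endomorphism of $(\mathbf{C}^\otimes)^{\otimes n}$. $\mathrm{Grp}_{\ast q}$ is the category of quasicomplexes: objects are sequences of groups $\mathsf{C}^n$ ($n\ge 0$) with unit-preserving functions $\partial:\mathsf{C}^n\to\mathsf{C}^{n+1}$ (no condition on $\partial^2$); arrows are collections of unit-preserving functions $f^n$ with $f^{n+1}\partial=\partial f^n$. *)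

(* Defs.v *)
From HB Require Import structures.
From mathcomp Require Import all_boot all_order all_algebra.
From mathcomp Require Import boolp classical_sets functions reals.
From mathcomp Require Import complex.

Set Implicit Arguments.
Unset Strict Implicit.
Unset Printing Implicit Defensive.

Import GRing.Theory.

Local Open Scope ring_scope.

(* [realType] is the library's axiomatisation of the real numbers. *)
Variant real_or_complex : fieldType -> Prop :=
| IsReal (R : realType) : real_or_complex R
| IsComplex (R : realType) : real_or_complex R[i].

(* The vector space generated by X subject to the relations in rel: formal
   combinations of generators modulo the congruence generated by rel.  Two
   combinations are identified when every map killing all the relations gives
   them the same value, which yields the universal property at once
   (pgen_respects, plift, pliftE, pmod_ind). *)
Section PresentedModule.
Context {K : fieldType} {X : choiceType}.
Variable rel : seq (K * X) -> Prop.
Implicit Types s t : seq (K * X).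

Definition lin_eval (W : lmodType K) (f : X -> W) s : W :=
  \sum_(p <- s) p.1 *: f p.2.

Definition respects (W : lmodType K) (f : X -> W) : Prop :=
  forall s, rel s -> lin_eval f s = 0.

Definition pequiv s t : bool :=
  `[< forall (W : lmodType K) (f : X -> W),
        respects f -> lin_eval f s = lin_eval f t >].

Lemma pequivP s t : reflect (forall (W : lmodType K) (f : X -> W),
  respects f -> lin_eval f s = lin_eval f t) (pequiv s t).
Proof. exact: asboolP. Qed.

Lemma pequiv_refl : reflexive pequiv.
Proof. by move=> s; apply/pequivP. Qed.

Lemma pequiv_sym : symmetric pequiv.
Proof. by move=> s t; apply/pequivP/pequivP => h W f fP; rewrite h. Qed.

Lemma pequiv_trans : transitive pequiv.
Proof.
move=> t s u /pequivP st /pequivP tu.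
by apply/pequivP => W f fP; rewrite st // tu.
Qed.

Canonical pequiv_equiv := EquivRel pequiv pequiv_refl pequiv_sym pequiv_trans.

Definition pmod : Type := {eq_quot pequiv_equiv}%qT.
HB.instance Definition _ := Choice.on pmod.

Definition pcls s : pmod := (\pi_({eq_quot pequiv_equiv}) s)%qT.
Definition prepr (x : pmod) : seq (K * X) := repr (x : {eq_quot pequiv_equiv}%qT).

Lemma preprK x : pcls (prepr x) = x. Proof. exact: reprK. Qed.

Lemma pclsP s t : (forall (W : lmodType K) (f : X -> W),
  respects f -> lin_eval f s = lin_eval f t) <-> pcls s = pcls t.
Proof.
split=> [h|/eqmodP/pequivP//]; apply/eqmodP; exact/pequivP.
Qed.

Lemma prepr_eval s (W : lmodType K) (f : X -> W) :
  respects f -> lin_eval f (prepr (pcls s)) = lin_eval f s.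
Proof. by move=> fP; apply: (pclsP _ _).2 => //; rewrite preprK. Qed.

Lemma lin_eval_cat (W : lmodType K) (f : X -> W) s t :
  lin_eval f (s ++ t) = lin_eval f s + lin_eval f t.
Proof. by rewrite /lin_eval big_cat. Qed.

Definition pscale_seq (a : K) s := [seq (a * p.1, p.2) | p <- s].

Lemma lin_eval_scale (W : lmodType K) (f : X -> W) a s :
  lin_eval f (pscale_seq a s) = a *: lin_eval f s.
Proof.
rewrite /lin_eval big_map scaler_sumr; apply: eq_bigr => p _.
by rewrite scalerA.
Qed.

Definition pzero := pcls [::].
Definition padd x y := pcls (prepr x ++ prepr y).
Definition pscale a x := pcls (pscale_seq a (prepr x)).
Definition popp x := pscale (-1) x.

Lemma pmod_ext x y : (forall (W : lmodType K) (f : X -> W),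
  respects f -> lin_eval f (prepr x) = lin_eval f (prepr y)) -> x = y.
Proof. by move=> h; rewrite -(preprK x) -(preprK y); apply/pclsP. Qed.

Lemma eval_padd x y (W : lmodType K) (f : X -> W) : respects f ->
  lin_eval f (prepr (padd x y)) =
  lin_eval f (prepr x) + lin_eval f (prepr y).
Proof. by move=> fP; rewrite prepr_eval // lin_eval_cat. Qed.

Lemma eval_pscale a x (W : lmodType K) (f : X -> W) : respects f ->
  lin_eval f (prepr (pscale a x)) = a *: lin_eval f (prepr x).
Proof. by move=> fP; rewrite prepr_eval // lin_eval_scale. Qed.

Lemma eval_pzero (W : lmodType K) (f : X -> W) : respects f ->
  lin_eval f (prepr pzero) = 0.
Proof. by move=> fP; rewrite prepr_eval // /lin_eval big_nil. Qed.

Let evalE := (eval_padd, eval_pscale, eval_pzero).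

Lemma paddA : associative padd.
Proof. by move=> x y z; apply: pmod_ext => W f fP; rewrite !evalE // addrA. Qed.
Lemma paddC : commutative padd.
Proof. by move=> x y; apply: pmod_ext => W f fP; rewrite !evalE // addrC. Qed.
Lemma padd0 : left_id pzero padd.
Proof. by move=> x; apply: pmod_ext => W f fP; rewrite !evalE // add0r. Qed.
Lemma paddN : left_inverse pzero popp padd.
Proof.
by move=> x; apply: pmod_ext => W f fP; rewrite !evalE // scaleN1r addNr.
Qed.

HB.instance Definition _ := GRing.isZmodule.Build pmod paddA paddC padd0 paddN.

Lemma pscaleA a b x : pscale a (pscale b x) = pscale (a * b) x.
Proof. by apply: pmod_ext => W f fP; rewrite !evalE // scalerA. Qed.
Lemma pscale1 : left_id 1 pscale.
Proof. by move=> x; apply: pmod_ext => W f fP; rewrite !evalE // scale1r. Qed.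
Lemma pscaleDr : right_distributive pscale +%R.
Proof. by move=> a x y; apply: pmod_ext => W f fP; rewrite !evalE // scalerDr. Qed.
Lemma pscaleDl x : {morph pscale^~ x : a b / a + b}.
Proof. by move=> a b; apply: pmod_ext => W f fP; rewrite !evalE // scalerDl. Qed.

HB.instance Definition _ :=
  GRing.Zmodule_isLmodule.Build K pmod pscaleA pscale1 pscaleDr pscaleDl.

Definition pgen (g : X) : pmod := pcls [:: (1, g)].

Section Lift.
Context {W : lmodType K} {f : X -> W} (fP : respects f).

Definition plift_fun of respects f := fun x : pmod => lin_eval f (prepr x).

Lemma plift_linear : linear (plift_fun fP).
Proof. by move=> a x y; rewrite /plift_fun !evalE. Qed.

HB.instance Definition _ := GRing.isLinear.Build K pmod W *:%R
  (plift_fun fP) plift_linear.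

End Lift.

Lemma pcls_sum s : pcls s = \sum_(p <- s) p.1 *: pgen p.2.
Proof.
elim: s => [|p s ih]; first by rewrite big_nil.
rewrite big_cons -ih; apply: pmod_ext => W f fP.
rewrite !evalE // !prepr_eval // /lin_eval big_cons big_seq1.
by rewrite scale1r.
Qed.

Lemma pgen_respects : respects pgen.
Proof.
move=> s sr; rewrite /lin_eval -pcls_sum; apply/pclsP => W f fP.
by rewrite fP // /lin_eval big_nil.
Qed.

Lemma pmod_ind (P : pmod -> Prop) : P 0 ->
  (forall a g x, P x -> P (a *: pgen g + x)) -> forall x, P x.
Proof.
move=> P0 Pg x; rewrite -(preprK x) pcls_sum.
elim: (prepr x) => [|p s ih]; first by rewrite big_nil.
by rewrite big_cons; apply: Pg.
Qed.

End PresentedModule.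

(* Locked, so that simplification does not expose representatives. *)
HB.lock Definition plift (K : fieldType) (X : choiceType)
    (rel : seq (K * X) -> Prop) (W : lmodType K) (f : X -> W)
    (fP : respects rel f) : {linear pmod rel -> W} := plift_fun fP.

Arguments plift {K X rel W f} fP.

Lemma pliftE (K : fieldType) (X : choiceType) (rel : seq (K * X) -> Prop)
    (W : lmodType K) (f : X -> W) (fP : respects rel f) g :
  plift fP (pgen rel g) = f g.
Proof.
by rewrite plift.unlock /= /plift_fun prepr_eval // /lin_eval big_seq1 scale1r.
Qed.

Section Tensor.
Context {K : fieldType}.
Implicit Types U V W : lmodType K.

(* U (x) V is presented by the pairs (u, v) and the bilinearity relations;
   [tens u v] is the pure tensor. *)
Inductive bilin_rel U V : seq (K * (U * V)) -> Prop :=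
| BilinRelL a u u' v :
    bilin_rel [:: (1, (a *: u + u', v)); (- a, (u, v)); (-1, (u', v))]
| BilinRelR a u v v' :
    bilin_rel [:: (1, (u, a *: v + v')); (- a, (u, v)); (-1, (u, v'))].

Definition tensor U V : lmodType K := pmod (@bilin_rel U V).

Definition tens U V (u : U) (v : V) : tensor U V := pgen (@bilin_rel U V) (u, v).

Definition bilin U V W (f : U -> V -> W) : Prop :=
  (forall v, linear (f^~ v)) /\ (forall u, linear (f u)).

Lemma lin3_eq0 (W : lmodType K) a (x y z : W) :
  x = a *: y + z <-> \sum_(p <- [:: (1, x); (- a, y); (-1, z)]) p.1 *: p.2 = 0.
Proof.
rewrite !big_cons big_nil /= addr0 scale1r scaleNr scaleN1r -opprD.
by split=> [->|/eqP]; rewrite ?subrr// subr_eq0 => /eqP.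
Qed.

Lemma tens_bilin U V : bilin (@tens U V).
Proof.
split=> [v a x y|u a x y]; apply/lin3_eq0.
- by have := pgen_respects (BilinRelL a x y v);
    rewrite /lin_eval !big_cons !big_nil.
- by have := pgen_respects (BilinRelR a u x y);
    rewrite /lin_eval !big_cons !big_nil.
Qed.

Lemma tensPl U V (v : V) a (x y : U) :
  tens (a *: x + y) v = a *: tens x v + tens y v.
Proof. exact: (tens_bilin U V).1. Qed.
Lemma tensPr U V (u : U) a (x y : V) :
  tens u (a *: x + y) = a *: tens u x + tens u y.
Proof. exact: (tens_bilin U V).2. Qed.
Definition tensr U V (u : U) : V -> tensor U V := fun v => tens u v.

HB.instance Definition _ U V (u : U) :=
  GRing.isLinear.Build K V (tensor U V) *:%R (@tensr U V u)
    ((tens_bilin U V).2 u).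

Definition tensl U V (v : V) : U -> tensor U V := fun u => tens u v.

HB.instance Definition _ U V (v : V) :=
  GRing.isLinear.Build K U (tensor U V) *:%R (@tensl U V v)
    ((tens_bilin U V).1 v).

Lemma tens0l U V (v : V) : tens (0 : U) v = 0.
Proof. by rewrite -{1}[0](addNr 0) -scaleN1r tensPl scaleN1r addNr. Qed.
Lemma tens0r U V (u : U) : tens u (0 : V) = 0.
Proof. by rewrite -{1}[0](addNr 0) -scaleN1r tensPr scaleN1r addNr. Qed.
Lemma tensZl U V (v : V) a (x : U) : tens (a *: x) v = a *: tens x v.
Proof. by rewrite -[a *: x]addr0 tensPl tens0l addr0. Qed.
Lemma tensZr U V (u : U) a (x : V) : tens u (a *: x) = a *: tens u x.
Proof. by rewrite -[a *: x]addr0 tensPr tens0r addr0. Qed.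

Lemma bilin_respects U V W (f : U -> V -> W) :
  bilin f -> respects (@bilin_rel U V) (fun p => f p.1 p.2).
Proof.
move=> [fl fr] s [a u u' v|a u v v']; rewrite /lin_eval.
- by have /lin3_eq0 := fl v a u u'; rewrite !big_cons !big_nil.
- by have /lin3_eq0 := fr u a v v'; rewrite !big_cons !big_nil.
Qed.

Definition tlift U V W (f : U -> V -> W) (fB : bilin f) :
  {linear tensor U V -> W} := plift (bilin_respects fB).

Lemma tliftE U V W (f : U -> V -> W) (fB : bilin f) u v :
  tlift fB (tens u v) = f u v.
Proof. exact: pliftE. Qed.

Lemma tens_ind U V (P : tensor U V -> Prop) : P 0 ->
  (forall a u v x, P x -> P (a *: tens u v + x)) -> forall x, P x.
Proof. by move=> P0 PS; apply: pmod_ind => // a [u v]; apply: PS. Qed.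

Lemma tens_ext U V W (f g : {linear tensor U V -> W}) :
  (forall u v, f (tens u v) = g (tens u v)) -> forall x, f x = g x.
Proof.
move=> fg; elim/tens_ind => [|a u v x ih]; first by rewrite !linear0.
by rewrite !linearP fg ih.
Qed.

Lemma tmap_bilin U V U' V' (f : {linear U -> U'}) (g : {linear V -> V'}) :
  bilin (fun u v => tens (f u) (g v)).
Proof. by split=> [v a x y|u a x y]; rewrite linearP (tensPl, tensPr). Qed.

Definition tmap U V U' V' (f : {linear U -> U'}) (g : {linear V -> V'}) :
  {linear tensor U V -> tensor U' V'} := tlift (tmap_bilin f g).

Lemma tmapE U V U' V' (f : {linear U -> U'}) (g : {linear V -> V'}) u v :
  tmap f g (tens u v) = tens (f u) (g v).
Proof. exact: tliftE. Qed.

Lemma tswap_bilin U V : bilin (fun (u : U) (v : V) => tens v u).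
Proof. by split=> [v a x y|u a x y]; rewrite (tensPl, tensPr). Qed.

Definition tswap U V : {linear tensor U V -> tensor V U} :=
  tlift (@tswap_bilin U V).

Lemma tswapE U V (u : U) (v : V) : tswap U V (tens u v) = tens v u.
Proof. exact: tliftE. Qed.

Lemma tassoc_inner U V W (w : W) : bilin (fun (u : U) (v : V) => tens u (tens v w)).
Proof. by split=> [v a x y|u a x y]; rewrite !(tensPl, tensPr). Qed.

Lemma tassoc_bilin U V W :
  bilin (fun (s : tensor U V) (w : W) => tlift (@tassoc_inner U V W w) s).
Proof.
split=> [w a x y|s a x y]; first exact: linearP.
elim/tens_ind: s => [|b u v s ih]; first by rewrite !linear0 addr0.
by rewrite !linearP ih !tliftE !tensPr !scalerDr !scalerA mulrC addrACA.
Qed.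

Definition tassoc U V W :
    {linear tensor (tensor U V) W -> tensor U (tensor V W)} :=
  tlift (@tassoc_bilin U V W).

Lemma tassocE U V W (u : U) (v : V) (w : W) :
  tassoc U V W (tens (tens u v) w) = tens u (tens v w).
Proof. by rewrite tliftE tliftE. Qed.

Lemma tassocV_inner U V W (u : U) : bilin (fun (v : V) (w : W) => tens (tens u v) w).
Proof. by split=> [w a x y|v a x y]; rewrite !(tensPl, tensPr). Qed.

Lemma tassocV_bilin U V W :
  bilin (fun (u : U) (s : tensor V W) => tlift (@tassocV_inner U V W u) s).
Proof.
split=> [s a x y|u a x y]; last exact: linearP.
elim/tens_ind: s => [|b v w s ih]; first by rewrite !linear0 addr0.
by rewrite !linearP ih !tliftE !tensPl !scalerDr !scalerA mulrC addrACA.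
Qed.

Definition tassocV U V W :
    {linear tensor U (tensor V W) -> tensor (tensor U V) W} :=
  tlift (@tassocV_bilin U V W).

Lemma tassocVE U V W (u : U) (v : V) (w : W) :
  tassocV U V W (tens u (tens v w)) = tens (tens u v) w.
Proof. by rewrite tliftE tliftE. Qed.

End Tensor.

(* The interchange u (x) v (x) u' (x) v' |-> u (x) u' (x) v (x) v'. *)
HB.lock Definition tmid (K : fieldType) (U V U' V' : lmodType K) :
    {linear tensor (tensor U V) (tensor U' V') ->
            tensor (tensor U U') (tensor V V')} :=
  tassocV U U' (tensor V V')
  \o tmap idfun (tassoc U' V V' \o tmap (tswap V U') idfun \o tassocV V U' V')
  \o tassoc U V (tensor U' V').

Arguments tmid {K} U V U' V'.

Section TensorForms.
Context {K : fieldType}.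
Implicit Types U V W : lmodType K.

Lemma tmidE U V U' V' (u : U) (v : V) (u' : U') (v' : V') :
  tmid U V U' V' (tens (tens u v) (tens u' v')) =
  tens (tens u u') (tens v v').
Proof.
by rewrite tmid.unlock /= tassocE tmapE /= tassocVE tmapE tswapE tassocE
  tassocVE.
Qed.

Lemma tform_bilin U V (f : {linear U -> K^o}) (g : {linear V -> K^o}) :
  bilin (fun u v => f u * g v : K^o).
Proof.
split=> [v a x y|u a x y]; rewrite linearP.
  by rewrite mulrDl -scalerAl.
by rewrite mulrDr -scalerAr.
Qed.

(* f (x) g, with K (x) K identified with K. *)
Definition tform U V (f : {linear U -> K^o}) (g : {linear V -> K^o}) :
  {linear tensor U V -> K^o} := tlift (tform_bilin f g).

Lemma tformE U V (f : {linear U -> K^o}) (g : {linear V -> K^o}) u v :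
  tform f g (tens u v) = f u * g v.
Proof. exact: tliftE. Qed.

Lemma tappl_bilin U V (f : {linear U -> K^o}) : bilin (fun u (v : V) => f u *: v).
Proof.
split=> [v a x y|u a x y]; first by rewrite linearP scalerDl scalerA.
by rewrite scalerDr !scalerA mulrC.
Qed.

(* f (x) I, with K (x) V identified with V. *)
Definition tappl U V (f : {linear U -> K^o}) : {linear tensor U V -> V} :=
  tlift (@tappl_bilin U V f).

Lemma tapplE U V (f : {linear U -> K^o}) u v : tappl V f (tens u v) = f u *: v.
Proof. exact: tliftE. Qed.

Lemma tappr_bilin U V (f : {linear V -> K^o}) : bilin (fun (u : U) v => f v *: u).
Proof.
split=> [v a x y|u a x y]; last by rewrite linearP scalerDl scalerA.
by rewrite scalerDr !scalerA mulrC.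
Qed.

(* I (x) f, with U (x) K identified with U. *)
Definition tappr U V (f : {linear V -> K^o}) : {linear tensor U V -> U} :=
  tlift (@tappr_bilin U V f).

Lemma tapprE U V (f : {linear V -> K^o}) u v : tappr U f (tens u v) = f v *: u.
Proof. exact: tliftE. Qed.

End TensorForms.

(* The tensor algebra, presented by the words v_1 ... v_r standing for
   v_1 (x) ... (x) v_r, modulo linearity in each letter; the product is
   concatenation and V^(x)r is spanned by the words of size r. *)
Section TensorAlgebra.
Context {K : fieldType} (V : lmodType K).
Implicit Types (w : seq V) (W : lmodType K).

Inductive word_rel : seq (K * seq V) -> Prop :=
| WordRel a u v w1 w2 :
    word_rel [:: (1, w1 ++ (a *: u + v) :: w2);
                 (- a, w1 ++ u :: w2); (-1, w1 ++ v :: w2)].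

Definition talg : Type := pmod word_rel.
HB.instance Definition _ := GRing.Lmodule.on talg.

Definition word w : talg := pgen word_rel w.

Definition multilin W (f : seq V -> W) : Prop := forall a u v w1 w2,
  f (w1 ++ (a *: u + v) :: w2) = a *: f (w1 ++ u :: w2) + f (w1 ++ v :: w2).

Lemma multilin_respects W (f : seq V -> W) : multilin f -> respects word_rel f.
Proof.
move=> fP s [a u v w1 w2]; have /lin3_eq0 := fP a u v w1 w2.
by rewrite /lin_eval !big_cons !big_nil.
Qed.

Lemma word_multilin : multilin word.
Proof.
move=> a u v w1 w2; apply/lin3_eq0.
by have := pgen_respects (WordRel a u v w1 w2);
  rewrite /lin_eval !big_cons !big_nil.
Qed.

Definition wlift W (f : seq V -> W) (fP : multilin f) : {linear talg -> W} :=
  plift (multilin_respects fP).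

Lemma wliftE W (f : seq V -> W) (fP : multilin f) w : wlift fP (word w) = f w.
Proof. exact: pliftE. Qed.

Lemma talg_ind (P : talg -> Prop) : P 0 ->
  (forall a w x, P x -> P (a *: word w + x)) -> forall x, P x.
Proof. exact: pmod_ind. Qed.

Lemma catl_multilin w : multilin (fun w' => word (w ++ w')).
Proof. by move=> a u v w1 w2; rewrite !catA word_multilin. Qed.

Lemma talg_mul_multilin y : multilin (fun w => wlift (catl_multilin w) y).
Proof.
move=> a u v w1 w2; elim/talg_ind: y => [|b w y ih].
  by rewrite !linear0 addr0.
rewrite !linearP ih !wliftE -!catA !cat_cons word_multilin.
by rewrite !scalerDr !scalerA mulrC addrACA.
Qed.

Definition talg_mul (x y : talg) : talg := wlift (talg_mul_multilin y) x.

Lemma word_cat w w' : talg_mul (word w) (word w') = word (w ++ w').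
Proof. by rewrite /talg_mul !wliftE. Qed.

Lemma talg_mulPl y : linear (talg_mul^~ y).
Proof. exact: linearP. Qed.

Lemma talg_mulPr x : linear (talg_mul x).
Proof.
move=> a y z; elim/talg_ind: x => [|b w x ih].
  by rewrite /talg_mul !linear0 addr0.
rewrite !talg_mulPl ih /talg_mul !wliftE linearP.
by rewrite !scalerDr !scalerA mulrC addrACA.
Qed.

Lemma talg_mul0l y : talg_mul 0 y = 0.
Proof. by rewrite /talg_mul linear0. Qed.

Lemma talg_mul0r x : talg_mul x 0 = 0.
Proof. by have := talg_mulPr x (-1) 0 0; rewrite scaleN1r addNr scaleN1r addNr. Qed.

Lemma talg_mulA : associative talg_mul.
Proof.
move=> x y z; elim/talg_ind: x => [|a w x ih]; first by rewrite !talg_mul0l.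
rewrite !talg_mulPl ih; congr (_ *: _ + _).
elim/talg_ind: y {x ih} => [|b w' y ih].
  by rewrite !(talg_mul0l, talg_mul0r).
rewrite !(talg_mulPl, talg_mulPr) ih; congr (_ *: _ + _).
elim/talg_ind: z {y ih} => [|c w'' z ih]; first by rewrite !talg_mul0r.
by rewrite !talg_mulPr ih !word_cat catA.
Qed.

Lemma talg_mul1l : left_id (word [::]) talg_mul.
Proof.
move=> x; elim/talg_ind: x => [|a w x ih]; first by rewrite talg_mul0r.
by rewrite talg_mulPr ih word_cat.
Qed.

Lemma talg_mul1r : right_id (word [::]) talg_mul.
Proof.
move=> x; elim/talg_ind: x => [|a w x ih]; first by rewrite talg_mul0l.
by rewrite talg_mulPl ih word_cat cats0.
Qed.

Lemma talg_mulDl : left_distributive talg_mul +%R.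
Proof. by move=> x y z; have := talg_mulPl z 1 x y; rewrite !scale1r. Qed.

Lemma talg_mulDr : right_distributive talg_mul +%R.
Proof. by move=> x y z; have := talg_mulPr x 1 y z; rewrite !scale1r. Qed.

Lemma aug_multilin : multilin (fun w => (nilp w)%:R : K^o).
Proof. by move=> a u v [|? ?] w2; rewrite /= scaler0 addr0. Qed.

Lemma talg_1neq0 : word [::] != 0.
Proof.
apply/eqP => /(congr1 (wlift aug_multilin)).
by rewrite wliftE linear0 => /eqP; rewrite oner_eq0.
Qed.

HB.instance Definition _ := GRing.Zmodule_isNzRing.Build talg
  talg_mulA talg_mul1l talg_mul1r talg_mulDl talg_mulDr talg_1neq0.

Lemma talg_scaleAl a (x y : talg) : a *: (x * y) = (a *: x) * y.
Proof. by rewrite -[a *: x]addr0 [RHS]talg_mulPl talg_mul0l addr0. Qed.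

HB.instance Definition _ := GRing.Lmodule_isLalgebra.Build K talg talg_scaleAl.

Lemma talg_scaleAr a (x y : talg) : a *: (x * y) = x * (a *: y).
Proof. by rewrite -[a *: y]addr0 [RHS]talg_mulPr talg_mul0r addr0. Qed.

HB.instance Definition _ := GRing.Lalgebra_isAlgebra.Build K talg talg_scaleAr.

Lemma wordM w w' : word w * word w' = word (w ++ w'). Proof. exact: word_cat. Qed.
Lemma word1 : word [::] = 1. Proof. by []. Qed.

End TensorAlgebra.

Section AlgebraMul.
Context {K : fieldType} (A : algType K).

Lemma amul_bilin : bilin (fun x y : A => x * y).
Proof.
split=> [y a x x'|x a y y']; first by rewrite mulrDl scalerAl.
by rewrite mulrDr scalerAr.
Qed.

Definition amul : {linear tensor A A -> A} := tlift amul_bilin.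

Lemma amulE x y : amul (tens x y) = x * y. Proof. exact: tliftE. Qed.

End AlgebraMul.

Section Coalgebras.
Context {K : fieldType}.
Implicit Types U V : lmodType K.

(* Coassociativity holds up to the associator; the counit laws are
   (eps (x) I) Delta = I = (I (x) eps) Delta. *)
Record coalg U := Coalg {
  copr : {linear U -> tensor U U};
  coun : {linear U -> K^o};
  coprA : forall x,
    tassoc U U U (tmap copr idfun (copr x)) = tmap idfun copr (copr x);
  counl : forall x, tappl U coun (copr x) = x;
  counr : forall x, tappr U coun (copr x) = x
}.

Definition is_comor U V (cU : coalg U) (cV : coalg V) (f : {linear U -> V}) :=
  (forall x, copr cV (f x) = tmap f f (copr cU x)) /\
  (forall x, coun cV (f x) = coun cU x).

Definition unit_copr : {linear K^o -> tensor K^o K^o} :=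
  @tensl K K^o K^o 1.

Lemma unit_coprA x : tassoc K^o K^o K^o (tmap unit_copr idfun (unit_copr x)) =
  tmap idfun unit_copr (unit_copr x).
Proof. by rewrite /= !tmapE /= tassocE. Qed.
Lemma unit_counl x : tappl K^o idfun (unit_copr x) = x.
Proof. by rewrite /= tapplE /=; exact: mulr1. Qed.
Lemma unit_counr x : tappr K^o idfun (unit_copr x) = x.
Proof. by rewrite /= tapprE scale1r. Qed.

Definition unit_coalg : coalg K^o := Coalg unit_coprA unit_counl unit_counr.

Section TensorCoalg.
Context {U V : lmodType K} (cU : coalg U) (cV : coalg V).

Definition tens_copr : {linear tensor U V -> tensor (tensor U V) (tensor U V)} :=
  tmid U U V V \o tmap (copr cU) (copr cV).

Definition tens_coun : {linear tensor U V -> K^o} := tform (coun cU) (coun cV).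

Lemma tens_coprE u v :
  tens_copr (tens u v) = tmid U U V V (tens (copr cU u) (copr cV v)).
Proof. by rewrite /= tmapE. Qed.

(* the interleaving used for both sides of coassociativity *)
Let M : {linear tensor (tensor U (tensor U U)) (tensor V (tensor V V)) ->
    tensor (tensor U V) (tensor (tensor U V) (tensor U V))} :=
  tmap idfun (tmid U U V V) \o tmid U (tensor U U) V (tensor V V).

Lemma tens_coprAl s t :
  tassoc _ _ _ (tmap tens_copr idfun (tmid U U V V (tens s t))) =
  M (tens (tassoc U U U (tmap (copr cU) idfun s))
          (tassoc V V V (tmap (copr cV) idfun t))).
Proof.
elim/(@tens_ind K): s => [|a u u' s ih]; first by rewrite !(linear0, tens0l).
rewrite !(linearP, tensPl) ih; congr (_ *: _ + _) => {s ih}.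
elim/(@tens_ind K): t => [|b v v' t ih]; first by rewrite !(linear0, tens0r).
rewrite !(linearP, tensPr) ih; congr (_ *: _ + _) => {t ih}.
rewrite tmidE !tmapE tens_coprE.
elim/(@tens_ind K): (copr cU u) => [|c x y s ih]; first by rewrite !(linear0, tens0l).
rewrite !(linearP, tensPl) ih; congr (_ *: _ + _) => {s ih}.
elim/(@tens_ind K): (copr cV v) => [|d z w s ih].
  by rewrite !(linear0, tens0l, tens0r).
rewrite !(linearP, tensPl, tensPr) ih; congr (_ *: _ + _) => {s ih}.
by rewrite /M /= !tassocE !tmidE !tassocE tmapE /= tmidE.
Qed.

Lemma tens_coprAr s t :
  tmap idfun tens_copr (tmid U U V V (tens s t)) =
  M (tens (tmap idfun (copr cU) s) (tmap idfun (copr cV) t)).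
Proof.
elim/(@tens_ind K): s => [|a u u' s ih]; first by rewrite !(linear0, tens0l).
rewrite !(linearP, tensPl) ih; congr (_ *: _ + _) => {s ih}.
elim/(@tens_ind K): t => [|b v v' t ih]; first by rewrite !(linear0, tens0r).
rewrite !(linearP, tensPr) ih; congr (_ *: _ + _) => {t ih}.
by rewrite /M /= tmidE !tmapE tens_coprE tmidE tmapE.
Qed.

Lemma tens_coprA x : tassoc _ _ _ (tmap tens_copr idfun (tens_copr x)) =
  tmap idfun tens_copr (tens_copr x).
Proof.
elim/(@tens_ind K): x => [|a u v x ih]; first by rewrite !linear0.
rewrite !linearP ih; congr (_ *: _ + _).
by rewrite tens_coprE tens_coprAl tens_coprAr !coprA.
Qed.

Lemma tens_counl x : tappl _ tens_coun (tens_copr x) = x.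
Proof.
elim/(@tens_ind K): x => [|a u v x ih]; first by rewrite !linear0.
rewrite !linearP ih; congr (_ *: _ + _); rewrite tens_coprE.
have -> : forall s t, tappl _ tens_coun (tmid U U V V (tens s t)) =
    tens (tappl U (coun cU) s) (tappl V (coun cV) t).
  move=> s t; elim/(@tens_ind K): s => [|b x1 x2 s ih']; first by rewrite !(linear0, tens0l).
  rewrite !(linearP, tensPl) ih'; congr (_ *: _ + _) => {s ih'}.
  elim/(@tens_ind K): t => [|d z w t {}ih]; first by rewrite !(linear0, tens0r).
  rewrite !(linearP, tensPr) ih; congr (_ *: _ + _).
  by rewrite tmidE !tapplE tformE tensZl tensZr scalerA.
by rewrite !counl.
Qed.

Lemma tens_counr x : tappr _ tens_coun (tens_copr x) = x.
Proof.
elim/(@tens_ind K): x => [|a u v x ih]; first by rewrite !linear0.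
rewrite !linearP ih; congr (_ *: _ + _); rewrite tens_coprE.
have -> : forall s t, tappr _ tens_coun (tmid U U V V (tens s t)) =
    tens (tappr U (coun cU) s) (tappr V (coun cV) t).
  move=> s t; elim/(@tens_ind K): s => [|b x1 x2 s ih']; first by rewrite !(linear0, tens0l).
  rewrite !(linearP, tensPl) ih'; congr (_ *: _ + _) => {s ih'}.
  elim/(@tens_ind K): t => [|d z w t {}ih]; first by rewrite !(linear0, tens0r).
  rewrite !(linearP, tensPr) ih; congr (_ *: _ + _).
  by rewrite tmidE !tapprE tformE tensZl tensZr scalerA.
by rewrite !counr.
Qed.

Definition tens_coalg : coalg (tensor U V) :=
  Coalg tens_coprA tens_counl tens_counr.

Lemma copr_tensE u v : copr tens_coalg (tens u v) =
  tmid U U V V (tens (copr cU u) (copr cV v)).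
Proof. exact: tens_coprE. Qed.

Lemma coun_tensE u v : coun tens_coalg (tens u v) = coun cU u * coun cV v.
Proof. exact: tformE. Qed.

End TensorCoalg.

(* V^(x)n as V (x) (V (x) (... (x) K)). *)
Fixpoint tpow U n : lmodType K :=
  if n is n'.+1 then tensor U (tpow U n') else K^o.

(* The usual coproduct and counit on the n-th tensor power of a coalgebra. *)
Fixpoint pow_coalg U (c : coalg U) n : coalg (tpow U n) :=
  if n is n'.+1 then tens_coalg c (pow_coalg c n') else unit_coalg.

End Coalgebras.

(* The product of the algebra A (x) B. *)
HB.lock Definition tmul2 (K : fieldType) (A B : algType K) :
    {linear tensor (tensor A B) (tensor A B) -> tensor A B} :=
  tmap (amul A) (amul B) \o tmid A B A B.

Arguments tmul2 {K} A B.

Section Bialgebras.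
Context {K : fieldType}.

Lemma tmul2E (A B : algType K) (a a' : A) (b b' : B) :
  tmul2 A B (tens (tens a b) (tens a' b')) = tens (a * a') (b * b').
Proof. by rewrite tmul2.unlock /= tmidE tmapE !amulE. Qed.

Record bialg (A : algType K) := Bialg {
  bialg_coalg :> coalg A;
  copr1 : copr bialg_coalg 1 = tens 1 1;
  coprM : forall x y, copr bialg_coalg (x * y) =
    tmul2 A A (tens (copr bialg_coalg x) (copr bialg_coalg y));
  coun1 : coun bialg_coalg 1 = 1;
  counM : forall x y,
    coun bialg_coalg (x * y) = coun bialg_coalg x * coun bialg_coalg y
}.

End Bialgebras.

Section TensorMul.
Context {K : fieldType} {A B : algType K}.

Lemma tmul2A (x y z : tensor A B) :
  tmul2 A B (tens x (tmul2 A B (tens y z))) =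
  tmul2 A B (tens (tmul2 A B (tens x y)) z).
Proof.
elim/(@tens_ind K): x => [|a u v x ih]; first by rewrite !(linear0, tens0l).
rewrite !(linearP, tensPl) ih; congr (_ *: _ + _) => {x ih}.
elim/(@tens_ind K): y => [|b u' v' y ih].
  by rewrite !(linear0, tens0r, tens0l).
rewrite !(linearP, tensPl, tensPr) ih; congr (_ *: _ + _) => {y ih}.
elim/(@tens_ind K): z => [|c u'' v'' z ih]; first by rewrite !(linear0, tens0r).
rewrite !(linearP, tensPr) ih; congr (_ *: _ + _).
by rewrite !tmul2E !mulrA.
Qed.

Lemma tmul2_1l (x : tensor A B) : tmul2 A B (tens (tens 1 1) x) = x.
Proof.
elim/(@tens_ind K): x => [|a u v x ih]; first by rewrite !(linear0, tens0r).
by rewrite !(linearP, tensPr) ih tmul2E !mul1r.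
Qed.

Lemma tmul2_1r (x : tensor A B) : tmul2 A B (tens x (tens 1 1)) = x.
Proof.
elim/(@tens_ind K): x => [|a u v x ih]; first by rewrite !(linear0, tens0l).
by rewrite !(linearP, tensPl) ih tmul2E !mulr1.
Qed.

End TensorMul.

(* The bialgebra structure on the tensor algebra of a coalgebra C: coproduct
   and counit are the algebra maps (talg_coprM, talg_counM) extending those
   of C (talg_copr_letter, talg_coun_letter). *)
Section TensorBialgebra.
Context {K : fieldType} {C : lmodType K} (c : coalg C).
Notation A := (talg C).

Definition letter (v : C) : A := word [:: v].

Lemma letter_linear : linear letter.
Proof. by move=> a u v; apply: (@word_multilin _ _ a u v [::] [::]). Qed.
HB.instance Definition _ :=
  GRing.isLinear.Build K C (talg C) *:%R letter letter_linear.

Definition word_copr (w : seq C) : tensor A A :=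
  foldr (fun v t => tmul2 A A (tens (tmap letter letter (copr c v)) t))
    (tens 1 1) w.

Definition word_coun (w : seq C) : K^o := \prod_(v <- w) coun c v.

Lemma word_copr_multilin : multilin word_copr.
Proof.
move=> a u v w1 w2; elim: w1 => [|v1 w1 ih] /=.
  by rewrite !linearP tensPl !linearP.
by rewrite ih tensPr linearP.
Qed.

Lemma word_coun_multilin : multilin word_coun.
Proof.
move=> a u v w1 w2; rewrite /word_coun !big_cat !big_cons /= linearP.
by rewrite mulrDl mulrDr -scalerAl -scalerAr.
Qed.

Definition talg_copr : {linear A -> tensor A A} := wlift word_copr_multilin.
Definition talg_coun : {linear A -> K^o} := wlift word_coun_multilin.

Lemma talg_copr1 : talg_copr 1 = tens 1 1.
Proof. by rewrite -word1 wliftE. Qed.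

Lemma talg_coun1 : talg_coun 1 = 1.
Proof. by rewrite -word1 wliftE /word_coun big_nil. Qed.

Lemma talg_copr_letter v :
  talg_copr (letter v) = tmap letter letter (copr c v).
Proof. by rewrite wliftE /= tmul2_1r. Qed.

Lemma talg_coun_letter v : talg_coun (letter v) = coun c v.
Proof. by rewrite wliftE /word_coun big_seq1. Qed.

Lemma talg_coprM x y :
  talg_copr (x * y) = tmul2 A A (tens (talg_copr x) (talg_copr y)).
Proof.
elim/(@talg_ind K): x => [|a w x ih]; first by rewrite mul0r !linear0 tens0l linear0.
rewrite mulrDl -scalerAl !linearP tensPl linearP ih; congr (_ *: _ + _).
elim/(@talg_ind K): y {ih} => [|b w' y ih].
  by rewrite mulr0 !linear0 tens0r linear0.
rewrite mulrDr -scalerAr !linearP tensPr linearP ih; congr (_ *: _ + _).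
rewrite wordM !wliftE; elim: w {ih} => [|v w ih] /=; first by rewrite tmul2_1l.
by rewrite ih tmul2A.
Qed.

Lemma talg_counM x y : talg_coun (x * y) = talg_coun x * talg_coun y.
Proof.
elim/(@talg_ind K): x => [|a w x ih]; first by rewrite mul0r !linear0 mul0r.
rewrite mulrDl -scalerAl !linearP mulrDl -scalerAl ih; congr (_ *: _ + _).
elim/(@talg_ind K): y {ih} => [|b w' y ih]; first by rewrite mulr0 !linear0 mulr0.
rewrite mulrDr -scalerAr !linearP mulrDr -scalerAr ih; congr (_ *: _ + _).
by rewrite wordM !wliftE /word_coun big_cat.
Qed.

(* An identity of linear maps on T(C) holds as soon as it holds at 1 and is
   stable under left multiplication by letters. *)
Lemma talg_word_ind (W : lmodType K) (f g : {linear A -> W}) :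
  (f 1 = g 1) -> (forall v x, f x = g x -> f (letter v * x) = g (letter v * x)) ->
  forall x, f x = g x.
Proof.
move=> fg1 fgS x; elim/(@talg_ind K): x => [|a w x ih]; first by rewrite !linear0.
rewrite !linearP ih; congr (_ *: _ + _); elim: w {x ih} => // v w ih.
by rewrite -cat1s -wordM fgS.
Qed.

Let mul3 : {linear tensor (tensor A (tensor A A)) (tensor A (tensor A A)) ->
    tensor A (tensor A A)} :=
  tmap (amul A) (tmul2 A A) \o tmid A (tensor A A) A (tensor A A).

Lemma mul3E a s a' s' : mul3 (tens (tens a s) (tens a' s')) =
  tens (a * a') (tmul2 A A (tens s s')).
Proof. by rewrite /mul3 /= tmidE tmapE amulE. Qed.

Lemma talg_coprMl s t :
  tassoc A A A (tmap talg_copr idfun (tmul2 A A (tens s t))) =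
  mul3 (tens (tassoc A A A (tmap talg_copr idfun s))
             (tassoc A A A (tmap talg_copr idfun t))).
Proof.
elim/(@tens_ind K): s => [|a u u' s ih]; first by rewrite !(linear0, tens0l).
rewrite !(linearP, tensPl) ih; congr (_ *: _ + _) => {s ih}.
elim/(@tens_ind K): t => [|b v v' t ih]; first by rewrite !(linear0, tens0r).
rewrite !(linearP, tensPr) ih; congr (_ *: _ + _) => {t ih}.
rewrite tmul2E !tmapE talg_coprM /=.
elim/(@tens_ind K): (talg_copr u) => [|d x y s ih].
  by rewrite !(linear0, tens0l).
rewrite !(linearP, tensPl) ih; congr (_ *: _ + _) => {s ih}.
elim/(@tens_ind K): (talg_copr v) => [|d' z w s ih].
  by rewrite !(linear0, tens0l, tens0r).
rewrite !(linearP, tensPl, tensPr) ih; congr (_ *: _ + _) => {s ih}.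
by rewrite tmul2E /mul3 /= !tassocE tmidE tmapE amulE tmul2E.
Qed.

Lemma talg_coprMr s t :
  tmap idfun talg_copr (tmul2 A A (tens s t)) =
  mul3 (tens (tmap idfun talg_copr s) (tmap idfun talg_copr t)).
Proof.
elim/(@tens_ind K): s => [|a u u' s ih]; first by rewrite !(linear0, tens0l).
rewrite !(linearP, tensPl) ih; congr (_ *: _ + _) => {s ih}.
elim/(@tens_ind K): t => [|b v v' t ih]; first by rewrite !(linear0, tens0r).
rewrite !(linearP, tensPr) ih; congr (_ *: _ + _) => {t ih}.
by rewrite tmul2E /mul3 /= !tmapE tmidE tmapE amulE talg_coprM.
Qed.

Lemma talg_coprA x : tassoc A A A (tmap talg_copr idfun (talg_copr x)) =
  tmap idfun talg_copr (talg_copr x).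
Proof.
pose f : {linear A -> tensor A (tensor A A)} :=
  tassoc A A A \o tmap talg_copr idfun \o talg_copr.
pose g : {linear A -> tensor A (tensor A A)} := tmap idfun talg_copr \o talg_copr.
apply: (@talg_word_ind _ f g) => [|v {}x]; rewrite /f /g /=.
  by rewrite !talg_copr1 !tmapE !talg_copr1 /= tassocE.
move=> ih; rewrite !talg_coprM talg_coprMl talg_coprMr ih.
congr (mul3 (tens _ _)); rewrite talg_copr_letter.
have hl s : tassoc A A A (tmap talg_copr idfun (tmap letter letter s)) =
    tmap letter (tmap letter letter) (tassoc C C C (tmap (copr c) idfun s)).
  elim/(@tens_ind K): s {ih} => [|a u u' s ih]; first by rewrite !linear0.
  rewrite !linearP ih; congr (_ *: _ + _).
  rewrite !tmapE talg_copr_letter /=.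
  elim/(@tens_ind K): (copr c u) => [|b y y' t {}ih].
    by rewrite !(linear0, tens0l).
  rewrite !(linearP, tensPl) ih; congr (_ *: _ + _).
  by rewrite tmapE !tassocE !tmapE.
have hr s : tmap idfun talg_copr (tmap letter letter s) =
    tmap letter (tmap letter letter) (tmap idfun (copr c) s).
  elim/(@tens_ind K): s {ih} => [|a u u' s ih]; first by rewrite !linear0.
  rewrite !linearP ih; congr (_ *: _ + _).
  by rewrite !tmapE talg_copr_letter.
by rewrite hl hr coprA.
Qed.

Lemma talg_counl x : tappl A talg_coun (talg_copr x) = x.
Proof.
pose f : {linear A -> A} := tappl A talg_coun \o talg_copr.
apply: (@talg_word_ind _ f idfun) => [|v {}x]; rewrite /f /=.
  by rewrite talg_copr1 tapplE talg_coun1 scale1r.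
move=> ih; rewrite talg_coprM.
have -> : forall s t, tappl A talg_coun (tmul2 A A (tens s t)) =
    tappl A talg_coun s * tappl A talg_coun t.
  move=> s t; elim/(@tens_ind K): s {ih} => [|a u u' s ih].
    by rewrite !(linear0, tens0l) mul0r.
  rewrite !(linearP, tensPl) ih mulrDl -scalerAl; congr (_ *: _ + _) => {s ih}.
  elim/(@tens_ind K): t => [|b y y' t ih].
    by rewrite !(linear0, tens0r) mulr0.
  rewrite !(linearP, tensPr) ih mulrDr -scalerAr; congr (_ *: _ + _).
  by rewrite tmul2E !tapplE talg_counM -scalerAl -scalerAr scalerA.
rewrite ih talg_copr_letter; congr (_ * _).
have -> s : tappl A talg_coun (tmap letter letter s) =
    letter (tappl C (coun c) s).
  elim/(@tens_ind K): s {ih} => [|a u u' s ih]; first by rewrite !linear0.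
  rewrite !linearP ih tmapE !tapplE talg_coun_letter; congr (_ *: _ + _).
  exact/esym/linearZ.
by rewrite counl.
Qed.

Lemma talg_counr x : tappr A talg_coun (talg_copr x) = x.
Proof.
pose f : {linear A -> A} := tappr A talg_coun \o talg_copr.
apply: (@talg_word_ind _ f idfun) => [|v {}x]; rewrite /f /=.
  by rewrite talg_copr1 tapprE talg_coun1 scale1r.
move=> ih; rewrite talg_coprM.
have -> : forall s t, tappr A talg_coun (tmul2 A A (tens s t)) =
    tappr A talg_coun s * tappr A talg_coun t.
  move=> s t; elim/(@tens_ind K): s {ih} => [|a u u' s ih].
    by rewrite !(linear0, tens0l) mul0r.
  rewrite !(linearP, tensPl) ih mulrDl -scalerAl; congr (_ *: _ + _) => {s ih}.
  elim/(@tens_ind K): t => [|b y y' t ih].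
    by rewrite !(linear0, tens0r) mulr0.
  rewrite !(linearP, tensPr) ih mulrDr -scalerAr; congr (_ *: _ + _).
  by rewrite tmul2E !tapprE talg_counM -scalerAl -scalerAr scalerA.
rewrite ih talg_copr_letter; congr (_ * _).
have -> s : tappr A talg_coun (tmap letter letter s) =
    letter (tappr C (coun c) s).
  elim/(@tens_ind K): s {ih} => [|a u u' s ih]; first by rewrite !linear0.
  rewrite !linearP ih tmapE !tapprE talg_coun_letter; congr (_ *: _ + _).
  exact/esym/linearZ.
by rewrite counr.
Qed.

Definition talg_coalg : coalg A := Coalg talg_coprA talg_counl talg_counr.

Definition talg_bialg : bialg A :=
  @Bialg _ A talg_coalg talg_copr1 talg_coprM talg_coun1 talg_counM.

End TensorBialgebra.

Lemma linear_ext (K : fieldType) (U W : lmodType K) (f g : {linear U -> W}) :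
  f =1 g -> f = g.
Proof.
case: f g => f [[f1] [f2]] [g [[g1] [g2]]] /= /funext fg.
by case: g / fg in g1 g2 *; rewrite (Prop_irrelevance f1 g1) (Prop_irrelevance f2 g2).
Qed.

Section Convolution.
Context {K : fieldType} {U : lmodType K} (cU : coalg U).

Definition conv (f g : {linear U -> K^o}) : {linear U -> K^o} :=
  tform f g \o copr cU.

Lemma convE f g x : conv f g x = tform f g (copr cU x). Proof. by []. Qed.

Lemma convA (f g h : {linear U -> K^o}) : conv f (conv g h) = conv (conv f g) h.
Proof.
apply: linear_ext => x /=.
pose t3 : {linear tensor U (tensor U U) -> K^o} := tform f (tform g h).
have -> : tform f (conv g h) (copr cU x) = t3 (tmap idfun (copr cU) (copr cU x)).
  elim/(@tens_ind K): (copr cU x) => [|a u v s ih]; first by rewrite !linear0.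
  by rewrite !linearP ih tmapE !tformE.
rewrite -coprA.
elim/(@tens_ind K): (copr cU x) => [|a u v s ih]; first by rewrite !linear0.
rewrite !linearP ih tmapE tformE; congr (_ *: _ + _).
rewrite /conv /=; elim/(@tens_ind K): (copr cU u) => [|b y z t {}ih].
  by rewrite !(linear0, tens0l) mul0r.
rewrite !(linearP, tensPl) ih mulrDl -scalerAl; congr (_ *: _ + _).
by rewrite tassocE !tformE mulrA.
Qed.

Lemma conv1l (f : {linear U -> K^o}) : conv (coun cU) f = f.
Proof.
apply: linear_ext => x; rewrite -[in RHS](counl cU x) /=.
elim/(@tens_ind K): (copr cU x) => [|a u v s ih]; first by rewrite !linear0.
rewrite !linearP ih tformE tapplE; congr (_ *: _ + _).
exact/esym/linearZ.
Qed.

Lemma conv1r (f : {linear U -> K^o}) : conv f (coun cU) = f.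
Proof.
apply: linear_ext => x; rewrite -[in RHS](counr cU x) /=.
elim/(@tens_ind K): (copr cU x) => [|a u v s ih]; first by rewrite !linear0.
rewrite !linearP ih tformE tapprE mulrC; congr (_ *: _ + _).
exact/esym/linearZ.
Qed.

(* Convolution-invertible functionals.  The inverse is carried along; being
   unique, it does not affect equality (conv_unit_ext). *)
Record conv_unit := ConvUnit {
  cu_val :> {linear U -> K^o};
  cu_inv : {linear U -> K^o};
  cu_valV : conv cu_val cu_inv = coun cU;
  cu_Vval : conv cu_inv cu_val = coun cU
}.

Lemma conv_unit_ext (f g : conv_unit) : cu_val f = cu_val g -> f = g.
Proof.
case: f g => [f f' fV Vf] [g g' gV Vg] /= fg.
case: g / fg gV Vg => gV Vg.
have fg' : f' = g' by rewrite -(conv1r f') -gV convA Vf conv1l.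
by case: g' / fg' gV Vg => gV Vg; rewrite (Prop_irrelevance fV gV) (Prop_irrelevance Vf Vg).
Qed.

HB.instance Definition _ := gen_eqMixin conv_unit.
HB.instance Definition _ := gen_choiceMixin conv_unit.

Definition cu_one : conv_unit := ConvUnit (conv1l (coun cU)) (conv1l (coun cU)).

Definition cu_opp (f : conv_unit) : conv_unit := ConvUnit (cu_Vval f) (cu_valV f).

Lemma cu_mul_proof (f g : conv_unit) :
  conv (conv f g) (conv (cu_inv g) (cu_inv f)) = coun cU.
Proof. by rewrite convA -(convA f) cu_valV conv1r cu_valV. Qed.

Definition cu_mul (f g : conv_unit) : conv_unit :=
  @ConvUnit (conv f g) (conv (cu_inv g) (cu_inv f))
    (cu_mul_proof f g) (cu_mul_proof (cu_opp g) (cu_opp f)).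

Lemma cu_mulA : associative cu_mul.
Proof. by move=> f g h; apply: conv_unit_ext; exact: convA. Qed.
Lemma cu_mul1l : left_id cu_one cu_mul.
Proof. by move=> f; apply: conv_unit_ext; exact: conv1l. Qed.
Lemma cu_mul1r : right_id cu_one cu_mul.
Proof. by move=> f; apply: conv_unit_ext; exact: conv1r. Qed.
Lemma cu_mulVl : left_inverse cu_one cu_opp cu_mul.
Proof. by move=> f; apply: conv_unit_ext; exact: cu_Vval. Qed.
Lemma cu_mulVr : right_inverse cu_one cu_opp cu_mul.
Proof. by move=> f; apply: conv_unit_ext; exact: cu_valV. Qed.

HB.instance Definition _ :=
  isGroup.Build conv_unit cu_mulA cu_mul1l cu_mul1r cu_mulVl cu_mulVr.

End Convolution.

Section Pullback.
Context {K : fieldType} {U V : lmodType K} (cU : coalg U) (cV : coalg V).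

Lemma conv_pull (h : {linear U -> V}) (f g : {linear V -> K^o}) :
  is_comor cU cV h -> conv cU (f \o h) (g \o h) = conv cV f g \o h.
Proof.
move=> [hD _]; apply: linear_ext => x /=; rewrite hD.
elim/(@tens_ind K): (copr cU x) => [|a u v s ih]; first by rewrite !linear0.
by rewrite !linearP ih tmapE !tformE.
Qed.

Lemma conv_pull_unit (h : {linear U -> V}) (f g : {linear V -> K^o}) :
  is_comor cU cV h -> conv cV f g = coun cV ->
  conv cU (f \o h) (g \o h) = coun cU.
Proof.
move=> hP fg; rewrite conv_pull // fg; apply: linear_ext => x /=.
exact: hP.2.
Qed.

Definition cu_pull (h : {linear U -> V}) (hP : is_comor cU cV h)
    (f : conv_unit cV) : conv_unit cU :=
  ConvUnit (conv_pull_unit hP (cu_valV f)) (conv_pull_unit hP (cu_Vval f)).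

Lemma conv_tform (f f' : {linear U -> K^o}) (g g' : {linear V -> K^o}) :
  conv (tens_coalg cU cV) (tform f g) (tform f' g') =
  tform (conv cU f f') (conv cV g g').
Proof.
apply: linear_ext => x.
elim/(@tens_ind K): x => [|a u v x ih]; first by rewrite !linear0.
rewrite !linearP ih; congr (_ *: _ + _); rewrite convE copr_tensE tformE !convE.
elim/(@tens_ind K): (copr cU u) => [|b y z s {}ih].
  by rewrite !(linear0, tens0l) mul0r.
rewrite !(linearP, tensPl) ih mulrDl -scalerAl; congr (_ *: _ + _).
elim/(@tens_ind K): (copr cV v) => [|d y' z' t {}ih].
  by rewrite !(linear0, tens0r) mulr0.
rewrite !(linearP, tensPr) ih mulrDr -scalerAr; congr (_ *: _ + _).
by rewrite tmidE !tformE mulrACA.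
Qed.

Lemma cu_tens_proof (f f' : {linear U -> K^o}) (g g' : {linear V -> K^o}) :
  conv cU f f' = coun cU -> conv cV g g' = coun cV ->
  conv (tens_coalg cU cV) (tform f g) (tform f' g') = coun (tens_coalg cU cV).
Proof. by move=> ff gg; rewrite conv_tform ff gg. Qed.

Definition cu_tens (f : conv_unit cU) (g : conv_unit cV) :
    conv_unit (tens_coalg cU cV) :=
  ConvUnit (cu_tens_proof (cu_valV f) (cu_valV g))
           (cu_tens_proof (cu_Vval f) (cu_Vval g)).

(* psi * I * psi^-1 = (psi (x) I (x) psi^-1) (I (x) Delta) Delta. *)
Definition conv_conj (f : conv_unit cU) : {linear U -> U} :=
  tappl U f \o tmap idfun (tappr U (cu_inv f)) \o (tmap idfun (copr cU) \o copr cU).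

End Pullback.

Section PowerMaps.
Context {K : fieldType} (A : algType K).

(* a_0 (x) ... (x) a_(n-1); the other values of a are irrelevant. *)
Fixpoint tprod n (a : nat -> A) : tpow A n :=
  if n is n'.+1 return tpow A n
  then tens (a 0%N) (tprod n' (fun i => a i.+1)) else (1 : K^o).

(* Multiplication of the factors number j + 1 and j + 2 (0 <= j <= n) of
   n + 2 factors, i.e. m_(j+1)^(n+1); j > n is not used. *)
Fixpoint mulat n j {struct n} : {linear tpow A n.+2 -> tpow A n.+1} :=
  match n, j return {linear tpow A n.+2 -> tpow A n.+1} with
  | n'.+1, j'.+1 => tmap idfun (mulat n' j')
  | n', _ => tmap (amul A) idfun \o tassocV A A (tpow A n')
  end.

(* Insertion of the unit after the j-th of n factors (0 <= j <= n); j > n is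
   not used. *)
Fixpoint unitat n j {struct n} : {linear tpow A n -> tpow A n.+1} :=
  match n, j return {linear tpow A n -> tpow A n.+1} with
  | n'.+1, j'.+1 => tmap idfun (unitat n' j')
  | n', _ => @tensr K A (tpow A n') 1
  end.

(* The identification of A^(x)n (x) A with A^(x)(n+1), and its inverse. *)
Fixpoint tsnoc n : {linear tensor (tpow A n) A -> tpow A n.+1} :=
  match n return {linear tensor (tpow A n) A -> tpow A n.+1} with
  | n'.+1 => tmap idfun (tsnoc n') \o tassoc A (tpow A n') A
  | 0 => tswap K^o A
  end.

Fixpoint tunsnoc n : {linear tpow A n.+1 -> tensor (tpow A n) A} :=
  match n return {linear tpow A n.+1 -> tensor (tpow A n) A} with
  | n'.+1 => tassocV A (tpow A n') A \o tmap idfun (tunsnoc n')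
  | 0 => tswap A K^o
  end.

Lemma tsnocK n : cancel (tsnoc n) (tunsnoc n).
Proof.
elim: n => [|n ih] x /=.
  elim/(@tens_ind K): x => [|a u v x ih]; first by rewrite !linear0.
  by rewrite !linearP ih !tswapE.
elim/(@tens_ind K): x => [|a s v x ih']; first by rewrite !linear0.
rewrite !linearP ih'; congr (_ *: _ + _) => {x ih'}.
elim/(@tens_ind K): s => [|b u s t ih']; first by rewrite !(linear0, tens0l).
rewrite !(linearP, tensPl) ih'; congr (_ *: _ + _).
by rewrite tassocE !tmapE ih tassocVE.
Qed.

Lemma tunsnocK n : cancel (tunsnoc n) (tsnoc n).
Proof.
elim: n => [|n ih] x /=.
  elim/(@tens_ind K): x => [|a u v x ih]; first by rewrite !linear0.
  by rewrite !linearP ih !tswapE.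
elim/(@tens_ind K): x => [|a u s x ih']; first by rewrite !linear0.
rewrite !linearP ih'; congr (_ *: _ + _) => {x ih'}.
rewrite tmapE /= -[in RHS](ih s).
elim/(@tens_ind K): (tunsnoc n s) => [|b w v t ih']; first by rewrite !(linear0, tens0r).
rewrite !(linearP, tensPr) ih'; congr (_ *: _ + _).
by rewrite tassocVE tassocE tmapE.
Qed.

Lemma tunsnoc_tprod n (a : nat -> A) :
  tunsnoc n (tprod n.+1 a) = tens (tprod n a) (a n).
Proof.
elim: n a => [|n ih] a; first by rewrite /= tswapE.
rewrite [tprod n.+2 a]/= [LHS]/= tmapE.
by rewrite (ih (fun i => a i.+1)) tassocVE.
Qed.

End PowerMaps.

Section Comorphisms.
Context {K : fieldType} {A : algType K} (b : bialg A).
Notation P := (pow_coalg b).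

Lemma tmap_comor (U V : lmodType K) (cU : coalg U) (cV : coalg V)
    (f : {linear U -> V}) : is_comor cU cV f ->
  is_comor (tens_coalg b cU) (tens_coalg b cV) (tmap idfun f).
Proof.
move=> [fD fe]; split=> x.
  elim/(@tens_ind K): x => [|a u v x ih]; first by rewrite !linear0.
  rewrite !linearP ih; congr (_ *: _ + _).
  rewrite tmapE !copr_tensE fD /=.
  elim/(@tens_ind K): (copr b u) => [|d y z s {}ih].
    by rewrite !(linear0, tens0l).
  rewrite !(linearP, tensPl) ih; congr (_ *: _ + _).
  elim/(@tens_ind K): (copr cU v) => [|d' y' z' t {}ih].
    by rewrite !(linear0, tens0r).
  rewrite !(linearP, tensPr) ih; congr (_ *: _ + _).
  by rewrite (tmapE f f) !tmidE !tmapE.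
elim/(@tens_ind K): x => [|a u v x ih]; first by rewrite !linear0.
by rewrite !linearP ih tmapE !coun_tensE fe.
Qed.

Lemma mul_comor (U : lmodType K) (cU : coalg U) :
  is_comor (tens_coalg b (tens_coalg b cU)) (tens_coalg b cU)
    (tmap (amul A) idfun \o tassocV A A U).
Proof.
pose f : {linear tensor A (tensor A U) -> tensor A U} :=
  tmap (amul A) idfun \o tassocV A A U.
have fE u v s : f (tens u (tens v s)) = tens (u * v) s.
  by rewrite /f /= tassocVE tmapE amulE.
rewrite -/f; split=> x.
  elim/(@tens_ind K): x => [|a u s x ih]; first by rewrite !linear0.
  rewrite !linearP ih; congr (_ *: _ + _) => {x ih}.
  elim/(@tens_ind K): s => [|d v s x ih]; first by rewrite !(linear0, tens0r).
  rewrite !(linearP, tensPr) ih; congr (_ *: _ + _) => {x ih}.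
  rewrite fE !copr_tensE coprM.
  elim/(@tens_ind K): (copr b u) => [|e y z t ih]; first by rewrite !(linear0, tens0l).
  rewrite !(linearP, tensPl) ih; congr (_ *: _ + _) => {t ih}.
  elim/(@tens_ind K): (copr b v) => [|e' y' z' t ih].
    by rewrite !(linear0, tens0l, tens0r).
  rewrite !(linearP, tensPl, tensPr) ih; congr (_ *: _ + _) => {t ih}.
  elim/(@tens_ind K): (copr cU s) => [|e'' y'' z'' t ih].
    by rewrite !(linear0, tens0r).
  rewrite !(linearP, tensPr) ih; congr (_ *: _ + _) => {t ih}.
  by rewrite tmul2E !tmidE tmapE !fE.
elim/(@tens_ind K): x => [|a u s x ih]; first by rewrite !linear0.
rewrite !linearP ih; congr (_ *: _ + _) => {x ih}.
elim/(@tens_ind K): s => [|d v s x ih]; first by rewrite !(linear0, tens0r).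
rewrite !(linearP, tensPr) ih; congr (_ *: _ + _).
by rewrite fE !coun_tensE counM mulrA.
Qed.

Lemma mulat_comor n j : is_comor (P n.+2) (P n.+1) (mulat A n j).
Proof.
elim: n j => [|n ih] [|j]; try exact: mul_comor.
exact: (tmap_comor (ih j)).
Qed.

Lemma unit_comor (U : lmodType K) (cU : coalg U) :
  is_comor cU (tens_coalg b cU) (@tensr K A U 1).
Proof.
split=> x; last by rewrite /tensr coun_tensE coun1 mul1r.
rewrite [LHS]copr_tensE copr1.
elim/(@tens_ind K): (copr cU x) => [|a u v s ih].
  by rewrite !(linear0, tens0r).
by rewrite !(linearP, tensPr) ih tmidE tmapE.
Qed.

Lemma unitat_comor n j : is_comor (P n) (P n.+1) (unitat A n j).
Proof.
elim: n j => [|n ih] [|j]; try exact: unit_comor.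
exact: (tmap_comor (ih j)).
Qed.

Lemma tswap_comor (U V : lmodType K) (cU : coalg U) (cV : coalg V) :
  is_comor (tens_coalg cU cV) (tens_coalg cV cU) (tswap U V).
Proof.
split=> x.
  elim/(@tens_ind K): x => [|a u v x ih]; first by rewrite !linear0.
  rewrite !linearP ih; congr (_ *: _ + _); rewrite tswapE !copr_tensE.
  elim/(@tens_ind K): (copr cU u) => [|d y z s {}ih].
    by rewrite !(linear0, tens0l, tens0r).
  rewrite !(linearP, tensPl, tensPr) ih; congr (_ *: _ + _).
  elim/(@tens_ind K): (copr cV v) => [|d' y' z' t {}ih].
    by rewrite !(linear0, tens0l, tens0r).
  rewrite !(linearP, tensPr, tensPl) ih; congr (_ *: _ + _).
  by rewrite !tmidE tmapE !tswapE.
elim/(@tens_ind K): x => [|a u v x ih]; first by rewrite !linear0.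
by rewrite !linearP ih tswapE !coun_tensE mulrC.
Qed.

Lemma tassocV_comor (U V W : lmodType K) (cU : coalg U) (cV : coalg V)
    (cW : coalg W) :
  is_comor (tens_coalg cU (tens_coalg cV cW))
           (tens_coalg (tens_coalg cU cV) cW) (tassocV U V W).
Proof.
split=> x.
  elim/(@tens_ind K): x => [|a u s x ih]; first by rewrite !linear0.
  rewrite !linearP ih; congr (_ *: _ + _) => {x ih}.
  elim/(@tens_ind K): s => [|d v w x ih]; first by rewrite !(linear0, tens0r).
  rewrite !(linearP, tensPr) ih; congr (_ *: _ + _) => {x ih}.
  rewrite tassocVE !copr_tensE.
  elim/(@tens_ind K): (copr cU u) => [|e y z t ih]; first by rewrite !(linear0, tens0l).
  rewrite !(linearP, tensPl) ih; congr (_ *: _ + _) => {t ih}.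
  elim/(@tens_ind K): (copr cV v) => [|e' y' z' t ih].
    by rewrite !(linear0, tens0l, tens0r).
  rewrite !(linearP, tensPl, tensPr) ih; congr (_ *: _ + _) => {t ih}.
  elim/(@tens_ind K): (copr cW w) => [|e'' y'' z'' t ih].
    by rewrite !(linear0, tens0r).
  rewrite !(linearP, tensPr) ih; congr (_ *: _ + _) => {t ih}.
  by rewrite !tmidE tmapE !tassocVE.
elim/(@tens_ind K): x => [|a u s x ih]; first by rewrite !linear0.
rewrite !linearP ih; congr (_ *: _ + _) => {x ih}.
elim/(@tens_ind K): s => [|d v w x ih]; first by rewrite !(linear0, tens0r).
rewrite !(linearP, tensPr) ih; congr (_ *: _ + _).
by rewrite tassocVE !coun_tensE mulrA.
Qed.

Lemma comp_comor (U V W : lmodType K) (cU : coalg U) (cV : coalg V)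
    (cW : coalg W) (f : {linear V -> W}) (g : {linear U -> V}) :
  is_comor cV cW f -> is_comor cU cV g -> is_comor cU cW (f \o g).
Proof.
move=> [fD fe] [gD ge]; split=> x /=; last by rewrite fe ge.
rewrite fD gD.
elim/(@tens_ind K): (copr cU x) => [|a u v s ih]; first by rewrite !linear0.
by rewrite !linearP ih !tmapE.
Qed.

Lemma tunsnoc_comor n : is_comor (P n.+1) (tens_coalg (P n) b) (tunsnoc A n).
Proof.
elim: n => [|n ih]; first exact: tswap_comor.
exact: (comp_comor (tassocV_comor b (P n) b) (tmap_comor ih)).
Qed.

End Comorphisms.

Section ConvolutionQuasicomplex.
Context {K : fieldType} {A : algType K} (b : bialg A).

Definition convG n : groupType := conv_unit (pow_coalg b n).

(* The cofaces: eps (x) psi for i = 0, psi (x) eps for i = n + 1, and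
   psi o m_i^n for 0 < i < n + 1; larger i are not used.  That these
   functionals are invertible is part of the construction. *)
Definition convG_coface n (i : nat) : convG n -> convG n.+1 :=
  if i == 0%N then fun psi => cu_tens (1%g : conv_unit b) psi
  else if i == n.+1 then
    fun psi => cu_pull (tunsnoc_comor b n) (cu_tens psi (1%g : conv_unit b))
  else match n return convG n -> convG n.+1 with
       | n'.+1 => cu_pull (mulat_comor b n' i.-1)
       | 0 => fun=> 1%g (* unreachable: no 1 <= i <= 0 *)
       end.

Definition convG_codeg n (i : nat) : convG n.+1 -> convG n := cu_pull (unitat_comor b n i).

Definition convG_cobound n (psi : convG n) : convG n.+1 :=
  ((\big[*%g/1%g]_(i <- iota 0 n.+2 | ~~ odd i) convG_coface i psi)^-1 *
   \big[*%g/1%g]_(i <- rev (iota 0 n.+2) | odd i) convG_coface i psi)%g.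

Lemma convG_coface1 n i : convG_coface i (1%g : convG n) = 1%g.
Proof.
have t1 (U V : lmodType K) (cU : coalg U) (cV : coalg V) :
    cu_tens (1%g : conv_unit cU) (1%g : conv_unit cV) = 1%g.
  exact: conv_unit_ext.
have p1 (U V : lmodType K) (cU : coalg U) (cV : coalg V) h
    (hP : is_comor cU cV h) : cu_pull hP 1%g = 1%g.
  by apply: conv_unit_ext; apply: linear_ext => x; apply: hP.2.
rewrite /convG_coface; case: eqP => _; first exact: t1.
case: eqP => _; first by rewrite t1 p1.
by case: n => [|n]; rewrite ?p1.
Qed.

Lemma convG_cobound1 n : convG_cobound (1%g : convG n) = 1%g.
Proof.
rewrite /convG_cobound !big1_seq ?invg1 ?mulg1 // => i _; exact: convG_coface1.
Qed.

End ConvolutionQuasicomplex.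

Section AutomorphismQuasicomplex.
Context {K : fieldType} (V : lmodType K).
Notation A := (talg V).

Definition is_subspace (U : lmodType K) (S : set U) : Prop :=
  S 0 /\ forall a u v, S u -> S v -> S (a *: u + v).

(* V^(x)R = V^(x)r_1 (x) ... (x) V^(x)r_n inside the n-th tensor power of the
   tensor algebra, for R = (r_1, ..., r_n) given as R 0, ..., R (n - 1); the
   other values of R are irrelevant. *)
Definition tgraded n (R : nat -> nat) : set (tpow A n) :=
  smallest (@is_subspace (tpow A n))
    [set tprod n (fun i => word (w i)) |
       w in [set w : nat -> seq V | forall i, (i < n)%N -> size (w i) = R i]].

Arguments tgraded n R : clear implicits.

(* Linear automorphisms of the n-th tensor power of the tensor algebra of V
   mapping every V^(x)R onto itself; the group law is composition. *)
Record gaut n := GAut {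
  ga_val :> {linear tpow A n -> tpow A n};
  ga_inv : {linear tpow A n -> tpow A n};
  ga_valK : cancel ga_val ga_inv;
  ga_invK : cancel ga_inv ga_val;
  ga_graded : forall R, (ga_val @` tgraded n R = tgraded n R)%classic
}.

Lemma gaut_ext n (f g : gaut n) : f =1 g -> f = g.
Proof.
case: f g => [f f' fV Vf fR] [g g' gV Vg gR] /= /linear_ext fg.
case: g / fg gV Vg gR => gV Vg gR.
have fg' : f' = g' by apply: linear_ext => x; rewrite -[in LHS](Vg x) fV.
case: g' / fg' gV Vg => gV Vg.
by rewrite (Prop_irrelevance fV gV) (Prop_irrelevance Vf Vg)
  (Prop_irrelevance fR gR).
Qed.

HB.instance Definition _ n := gen_eqMixin (gaut n).
HB.instance Definition _ n := gen_choiceMixin (gaut n).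

Lemma ga_one_graded n R : (idfun @` tgraded n R = tgraded n R)%classic.
Proof. exact: image_id. Qed.

Definition ga_one n : gaut n :=
  @GAut n idfun idfun (fun=> erefl) (fun=> erefl) (ga_one_graded n).

Lemma ga_opp_graded n (f : gaut n) R :
  (ga_inv f @` tgraded n R = tgraded n R)%classic.
Proof.
rewrite -{1}(ga_graded f R) image_comp -[RHS]image_id.
by apply: eq_imagel => x _; rewrite /= ga_valK.
Qed.

Definition ga_opp n (f : gaut n) : gaut n :=
  GAut (ga_invK f) (ga_valK f) (ga_opp_graded f).

Lemma ga_mul_graded n (f g : gaut n) R :
  ((f \o g) @` tgraded n R = tgraded n R)%classic.
Proof. by rewrite -image_comp !ga_graded. Qed.

Definition ga_mul n (f g : gaut n) : gaut n :=
  @GAut n (f \o g) (ga_inv g \o ga_inv f)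
    (can_comp (ga_valK f) (ga_valK g)) (can_comp (ga_invK g) (ga_invK f))
    (ga_mul_graded f g).

Lemma ga_mulA n : associative (@ga_mul n).
Proof. by move=> f g h; apply: gaut_ext. Qed.
Lemma ga_mul1l n : left_id (ga_one n) (@ga_mul n).
Proof. by move=> f; apply: gaut_ext. Qed.
Lemma ga_mul1r n : right_id (ga_one n) (@ga_mul n).
Proof. by move=> f; apply: gaut_ext. Qed.
Lemma ga_mulVl n : left_inverse (ga_one n) (@ga_opp n) (@ga_mul n).
Proof. by move=> f; apply: gaut_ext => x; apply: ga_valK. Qed.
Lemma ga_mulVr n : right_inverse (ga_one n) (@ga_opp n) (@ga_mul n).
Proof. by move=> f; apply: gaut_ext => x; apply: ga_invK. Qed.

HB.instance Definition _ n := isGroup.Build (gaut n)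
  (@ga_mulA n) (@ga_mul1l n) (@ga_mul1r n) (@ga_mulVl n) (@ga_mulVr n).

Lemma tgraded_subspace n R : is_subspace (@tgraded n R).
Proof.
split=> [S [[]]//|a u v gu gv S SP]; apply: SP.1.2; [exact: gu|exact: gv].
Qed.

Lemma tgraded_gen n R (w : nat -> seq V) :
  (forall i, (i < n)%N -> size (w i) = R i) ->
  tgraded n R (tprod n (fun i => word (w i))).
Proof. by move=> wR S [_]; apply; exists w. Qed.

Lemma tgraded_ind n R (S : set (tpow A n)) : is_subspace S ->
  (forall w : nat -> seq V, (forall i, (i < n)%N -> size (w i) = R i) ->
     S (tprod n (fun i => word (w i)))) ->
  forall x, tgraded n R x -> S x.
Proof. by move=> S0 Sw x; apply; split=> // _ [w wR <-]; apply: Sw. Qed.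

Lemma preim_subspace (U W : lmodType K) (f : {linear U -> W}) (S : set W) :
  is_subspace S -> is_subspace [set x | S (f x)].
Proof.
move=> [S0 SP]; split=> /= [|a u v Su Sv]; first by rewrite linear0.
by rewrite linearP; apply: SP.
Qed.

Lemma graded_val n (f : gaut n) R x : tgraded n R x -> tgraded n R (f x).
Proof. by move=> Rx; rewrite -(ga_graded f R); exists x. Qed.

Lemma graded_image n (f g : {linear tpow A n -> tpow A n}) :
  cancel g f ->
  (forall R x, tgraded n R x -> tgraded n R (f x)) ->
  (forall R x, tgraded n R x -> tgraded n R (g x)) ->
  forall R, (f @` tgraded n R = tgraded n R)%classic.
Proof.
move=> gK fR gR R; apply/seteqP; split=> [_ [x Rx <-]|x Rx]; first exact: fR.
by exists (g x); [exact: gR|rewrite gK].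
Qed.

Lemma tgraded_cons n R w x : size w = R 0%N ->
  tgraded n (fun i => R i.+1) x -> tgraded n.+1 R (tens (word w) x).
Proof.
move=> wR; apply: (tgraded_ind (preim_subspace (@tensr K A _ (word w))
  (tgraded_subspace n.+1 R))) => ws wsR.
apply: (@tgraded_gen n.+1 R (fun i => if i is j.+1 then ws j else w)).
by move=> [|i] //; apply: wsR.
Qed.

Lemma eq_tprod n (a a' : nat -> A) : (forall i, (i < n)%N -> a i = a' i) ->
  tprod n a = tprod n a'.
Proof.
elim: n a a' => //= n ih a a' aa; rewrite (aa 0%N) //.
by rewrite (ih _ (fun i => a' i.+1)) // => i ltin; apply: aa.
Qed.

Lemma tgraded_rcons n R w x : size w = R n ->
  tgraded n R x -> tgraded n.+1 R (tsnoc A n (tens x (word w))).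
Proof.
move=> wR; apply: (tgraded_ind (preim_subspace
  (tsnoc A n \o @tensl K (tpow A n) A (word w))
  (tgraded_subspace n.+1 R))) => ws wsR /=.
have -> : tsnoc A n (tensl (word w) (tprod n (fun i => word (ws i)))) =
    tprod n.+1 (fun i => word (if (i < n)%N then ws i else w)).
  rewrite -[RHS]tunsnocK tunsnoc_tprod ltnn; congr (tsnoc A n (tens _ _)).
  by apply: eq_tprod => i ->.
apply: tgraded_gen => i; rewrite ltnS leq_eqVlt.
by case: ltnP => [/wsR //|]; rewrite orbF => _ /eqP->.
Qed.

Lemma ga_coface0_graded n (f : gaut n) R x :
  tgraded n.+1 R x -> tgraded n.+1 R (tmap (@idfun A) f x).
Proof.
apply: (tgraded_ind (preim_subspace _ (tgraded_subspace n.+1 R))) => w wR.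
rewrite /= tmapE; apply: tgraded_cons; first exact: wR.
by apply: graded_val; apply: tgraded_gen => i ltin; apply: wR.
Qed.

Lemma tmap_idK (U W W' : lmodType K) (f : {linear W -> W'}) (g : {linear W' -> W}) :
  cancel f g -> cancel (tmap (@idfun U) f) (tmap (@idfun U) g).
Proof.
move=> fK x; elim/(@tens_ind K): x => [|a u v x ih]; first by rewrite !linear0.
by rewrite !linearP ih !tmapE fK.
Qed.

Definition ga_coface0 n (f : gaut n) : gaut n.+1 :=
  @GAut n.+1 (tmap idfun f) (tmap idfun (ga_inv f))
    (@tmap_idK A _ _ _ _ (ga_valK f)) (@tmap_idK A _ _ _ _ (ga_invK f))
    (@graded_image n.+1 (tmap idfun f) (tmap idfun (ga_inv f))
      (@tmap_idK A _ _ _ _ (ga_invK f))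
      (@ga_coface0_graded n f) (@ga_coface0_graded n (ga_opp f))).

Definition tright n (f : {linear tpow A n -> tpow A n}) :
    {linear tpow A n.+1 -> tpow A n.+1} :=
  tsnoc A n \o tmap f idfun \o tunsnoc A n.

Lemma tright_graded n (f : gaut n) R x :
  tgraded n.+1 R x -> tgraded n.+1 R (tright f x).
Proof.
apply: (tgraded_ind (preim_subspace _ (tgraded_subspace n.+1 R))) => w wR.
change (tgraded n.+1 R (tsnoc A n (tmap f idfun
  (tunsnoc A n (tprod n.+1 (fun i => word (w i))))))).
rewrite tunsnoc_tprod tmapE; apply: tgraded_rcons; first exact: wR.
by apply: graded_val; apply: tgraded_gen => i ltin; apply/wR/leqW.
Qed.

Lemma trightK n (f g : {linear tpow A n -> tpow A n}) :
  cancel f g -> cancel (tright f) (tright g).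
Proof.
move=> fK x; rewrite /tright /= tsnocK -[RHS]tunsnocK; congr (tsnoc A n _).
elim/(@tens_ind K): (tunsnoc A n x) => [|a u v y ih]; first by rewrite !linear0.
by rewrite !linearP ih !tmapE fK.
Qed.

Definition ga_coface_last n (f : gaut n) : gaut n.+1 :=
  @GAut n.+1 (tright f) (tright (ga_inv f))
    (trightK (ga_valK f)) (trightK (ga_invK f))
    (graded_image (trightK (ga_invK f))
      (@tright_graded n f) (@tright_graded n (ga_opp f))).

(* For 0 < i < n + 1 the coface is the element theta with
   m_i theta = psi m_i, which is unique (gaut_coface_unique); likewise for
   the codegeneracies, with the insertions of the unit.  The default value 1
   of [xget] is never used, since such elements exist. *)
Definition gaut_coface n (i : nat) : gaut n -> gaut n.+1 :=
  if i == 0%N then @ga_coface0 n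
  else if i == n.+1 then @ga_coface_last n
  else match n return gaut n -> gaut n.+1 with
       | n'.+1 => fun psi => xget 1%g
           [set theta : gaut n'.+2 |
              forall x, mulat A n' i.-1 (theta x) = psi (mulat A n' i.-1 x)]
       | 0 => fun=> 1%g (* unreachable: no 1 <= i <= 0 *)
       end.

Definition gaut_codeg n (i : nat) (psi : gaut n.+1) : gaut n :=
  xget 1%g [set theta : gaut n |
    forall x, unitat A n i (theta x) = psi (unitat A n i x)].

Definition gaut_cobound n (psi : gaut n) : gaut n.+1 :=
  ((\big[*%g/1%g]_(i <- iota 0 n.+2 | odd i) gaut_coface i psi) *
   (\big[*%g/1%g]_(i <- rev (iota 0 n.+2) | ~~ odd i) gaut_coface i psi)^-1)%g.

Lemma split_multilin r :
  multilin (fun w : seq V => tens (word (take r w)) (word (drop r w))).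
Proof.
move=> a u v w1 w2; rewrite !take_cat !drop_cat.
case: ltnP => [ltrw|lewr]; first by rewrite word_multilin tensPr.
case: (r - size w1)%N => [|k] /=; last by rewrite word_multilin tensPl.
by rewrite (@word_multilin K V a u v [::]) tensPr.
Qed.

Definition tsplit r : {linear A -> tensor A A} := wlift (split_multilin r).

Lemma mulat_split n j R : exists s : {linear tpow A n.+1 -> tpow A n.+2},
  forall x, tgraded n.+2 R x -> s (mulat A n j x) = x.
Proof.
have subK m (f : {linear tpow A m -> tpow A m}) : is_subspace [set x | f x = x].
  by split=> /= [|a u v fu fv]; [rewrite linear0|rewrite linearP fu fv].
have base m Q : exists s : {linear tpow A m.+1 -> tpow A m.+2},
    forall x, tgraded m.+2 Q x ->
    s ((tmap (amul A) idfun \o tassocV A A (tpow A m)) x) = x.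
  pose s : {linear tpow A m.+1 -> tpow A m.+2} :=
    tassoc A A (tpow A m) \o tmap (tsplit (Q 0%N)) idfun.
  exists s; apply: (tgraded_ind (subK _
    (s \o (tmap (amul A) idfun \o tassocV A A (tpow A m))))) => w wQ /=.
  rewrite tassocVE tmapE amulE tmapE wordM wliftE.
  have <- : size (w 0%N) = Q 0%N by apply: wQ.
  by rewrite take_size_cat // drop_size_cat // tassocE.
elim: n j R => [|n ih] [|j] R; try exact: base.
have [s sK] := ih j (fun i => R i.+1).
pose s' : {linear tpow A n.+2 -> tpow A n.+3} := tmap idfun s.
exists s'; apply: (tgraded_ind (subK _ (s' \o mulat A n.+1 j.+1))) => w wR.
pose t := tprod n.+2 (fun i => word (w i.+1)).
change (tmap idfun s (tmap idfun (mulat A n j) (tens (word (w 0%N)) t)) =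
  tens (word (w 0%N)) t).
rewrite !tmapE; congr tens; apply: sK.
by apply: (@tgraded_gen n.+2 _ (fun i => w i.+1)) => i lti; apply: wR.
Qed.

Lemma tprod_word_ext n (W : lmodType K) (f g : {linear tpow A n -> W}) :
  (forall w : nat -> seq V,
     f (tprod n (fun i => word (w i))) = g (tprod n (fun i => word (w i)))) ->
  f =1 g.
Proof.
elim: n W f g => [|n ih] W f g fg x.
  have -> : x = (x : K) *: (1 : K^o) :> tpow A 0 by exact/esym/mulr1.
  by rewrite [LHS]linearZ [RHS]linearZ; congr (_ *: _); exact: (fg (fun=> [::])).
elim/(@tens_ind K): x => [|a u v x ihx]; first by rewrite !linear0.
rewrite !linearP ihx; congr (_ *: _ + _) => {x ihx}.
elim/(@talg_ind K): u => [|d w u ihu]; first by rewrite tens0l !linear0.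
rewrite tensPl !linearP ihu; congr (_ *: _ + _) => {u ihu}.
apply: (ih _ (f \o @tensr K A _ (word w)) (g \o @tensr K A _ (word w))) => ws.
exact: (fg (fun i => if i is j.+1 then ws j else w)).
Qed.

Lemma gaut_coface_unique n j (psi : {linear tpow A n.+1 -> tpow A n.+1})
    (t1 t2 : gaut n.+2) :
  (forall x, mulat A n j (t1 x) = psi (mulat A n j x)) ->
  (forall x, mulat A n j (t2 x) = psi (mulat A n j x)) -> t1 = t2.
Proof.
move=> t1P t2P; apply/gaut_ext/tprod_word_ext => w.
have [s sK] := mulat_split n j (fun i => size (w i)).
have wR := @tgraded_gen n.+2 (fun i => size (w i)) w (fun _ _ => erefl).
by rewrite -[LHS]sK ?t1P -?t2P ?sK //; apply: graded_val.
Qed.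

Lemma gaut_coface1 n i : gaut_coface i (1%g : gaut n) = 1%g.
Proof.
rewrite /gaut_coface; case: eqP => _.
  apply: gaut_ext => x /=.
  elim/(@tens_ind K): x => [|a u v x ih]; first by rewrite linear0.
  by rewrite linearP ih tmapE.
case: eqP => _.
  apply: gaut_ext => x; rewrite -[RHS]tunsnocK; congr (tsnoc A n _).
  elim/(@tens_ind K): (tunsnoc A n x) => [|a u v y ih]; first by rewrite linear0.
  by rewrite linearP ih tmapE.
case: n => // n; apply: xget_unique => // t tP.
exact: (@gaut_coface_unique n i.-1 idfun t 1%g).
Qed.

Lemma gaut_cobound1 n : gaut_cobound (1%g : gaut n) = 1%g.
Proof.
rewrite /gaut_cobound !big1_seq ?invg1 ?mulg1 // => i _; exact: gaut_coface1.
Qed.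

End AutomorphismQuasicomplex.

Record quasicomplex := Quasicomplex {
  qc_grp :> nat -> groupType;
  qc_d : forall n, qc_grp n -> qc_grp n.+1;
  qc_d1 : forall n, qc_d (1%g : qc_grp n) = 1%g
}.

Definition is_qc_hom (X Y : quasicomplex) (f : forall n, X n -> Y n) : Prop :=
  (forall n, f n 1%g = 1%g) /\
  (forall n (x : X n), f n.+1 (qc_d x) = qc_d (f n x)).

Definition convG_qc (K : fieldType) (A : algType K) (b : bialg A) : quasicomplex :=
  @Quasicomplex (convG b) (@convG_cobound K A b) (@convG_cobound1 K A b).

Definition gaut_qc (K : fieldType) (V : lmodType K) : quasicomplex :=
  @Quasicomplex (fun n => gaut V n) (@gaut_cobound K V) (@gaut_cobound1 K V).

(* Main.v *)
Require Import Defs.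
From HB Require Import structures.
From mathcomp Require Import all_boot all_order all_algebra.
From mathcomp Require Import boolp classical_sets functions reals.

Import GRing.Theory.

Local Open Scope ring_scope.

Set Implicit Arguments.
Unset Strict Implicit.

(** A functional [f] on a coalgebra [U] acts on [U] in two ways, written in
    Sweedler notation [ltrans f x = f(x1) x2] and [rtrans f x = x1 f(x2)].
    Coassociativity says that the two actions commute, that [ltrans] reverses
    convolution products and that [rtrans] preserves them; as
    [conv_conj f = rtrans (f^-1) \o ltrans f] ([conv_conjE]), conjugation is
    an anti-homomorphism into the linear automorphisms of [U] ([conv_conjM]).

    Everything else follows from three properties of conjugation on an
    arbitrary coalgebra.
    - It is natural: [h (conv_conj (f \o h) x) = conv_conj f (h x)] for every
      coalgebra morphism [h] ([conv_conj_pull]).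
    - It is multiplicative: conjugation by [f (x) g] is the tensor product of
      the conjugations by [f] and by [g] ([conv_conj_tens]).
    - It stabilises every subspace [S] such that the coproduct maps [S] into
      [S (x) S] ([conv_conj_stable]).

    The coproduct of the tensor algebra sends a letter to tensors of letters
    and is an algebra map, so it sends a word of size [r] to tensors of words
    of size [r]; the last property then makes conjugation an element of
    [gaut C n].  The multiplications and the insertions of the unit are
    coalgebra morphisms, so naturality is literally the equation that defines
    the inner cofaces and the codegeneracies of [gaut C], and these equations
    have only one solution: a multiplication can be undone on each component
    of the grading, and an insertion of the unit is injective.  The two outer
    cofaces are tensor products with the counit, conjugation by which is the
    identity.  Finally, an anti-homomorphism that commutes with the cofaces
    carries one coboundary to the other, because the two are written with
    opposite orders of factors. *)

(** * Actions of functionals on a coalgebra *)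

Section Translations.
Context {K : fieldType} {U : lmodType K} (cU : coalg U).
Implicit Types f g : {linear U -> K^o}.

Definition ltrans f : {linear U -> U} := tappl U f \o copr cU.
Definition rtrans f : {linear U -> U} := tappr U f \o copr cU.

Lemma ltransE f x : ltrans f x = tappl U f (copr cU x). Proof. by []. Qed.
Lemma rtransE f x : rtrans f x = tappr U f (copr cU x). Proof. by []. Qed.

Lemma tappl_tmap (V W : lmodType K) f (h : {linear V -> W}) s :
  tappl W f (tmap idfun h s) = h (tappl V f s).
Proof.
elim/(@tens_ind K): s => [|a u v s ih]; first by rewrite !linear0.
by rewrite !linearP ih tmapE !tapplE [in RHS]linearZ.
Qed.

Lemma tappr_tmap (V W : lmodType K) f (h : {linear V -> W}) s :
  tappr W f (tmap h idfun s) = h (tappr V f s).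
Proof.
elim/(@tens_ind K): s => [|a u v s ih]; first by rewrite !linear0.
by rewrite !linearP ih tmapE !tapprE [in RHS]linearZ.
Qed.

Lemma tappr_assoc f (s : tensor (tensor U U) U) :
  tmap idfun (tappr U f) (tassoc U U U s) = tappr (tensor U U) f s.
Proof.
elim/(@tens_ind K): s => [|a u v s ih]; first by rewrite !linear0.
rewrite !linearP ih tapprE; congr (_ *: _ + _) => {s ih}.
elim/(@tens_ind K): u => [|b x y s ih]; first by rewrite tens0l !linear0.
by rewrite tensPl !linearP ih tassocE tmapE tapprE tensZr.
Qed.

(** Separates the contributions of [f] and of its inverse, so that the
    properties of conjugation reduce to those of the two actions. *)
Lemma conv_conjE (f : conv_unit cU) x :
  conv_conj f x = rtrans (cu_inv f) (ltrans f x).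
Proof. by rewrite /conv_conj /= !tappl_tmap. Qed.

(** Both sides are [f(x1) x2 g(x3)], bracketed in the two ways that
    coassociativity identifies. *)
Lemma ltrans_rtransC f g x : ltrans f (rtrans g x) = rtrans g (ltrans f x).
Proof.
by rewrite /ltrans /rtrans /= -!tappl_tmap -coprA tappr_assoc tappr_tmap.
Qed.

(** The functional applied last reads the later factor of the iterated
    coproduct: both sides are [f(x1) g(x2) x3]. *)
Lemma ltrans_conv f g x : ltrans g (ltrans f x) = ltrans (conv cU f g) x.
Proof.
rewrite /ltrans /= -tappl_tmap -coprA.
elim/(@tens_ind K): (copr cU x) => [|a u v s ih]; first by rewrite !linear0.
rewrite !linearP ih tmapE tapplE convE; congr (_ *: _ + _) => {s ih}.
elim/(@tens_ind K): (copr cU u) => [|b y z s ih].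
  by rewrite tens0l !linear0 scale0r.
rewrite tensPl !linearP ih tassocE tapplE [tappl _ _ (_ *: _)]linearZ /= tapplE.
by rewrite tformE scalerDl !scalerA.
Qed.

(** Mirror image of [ltrans_conv]: both sides are [x1 g(x2) f(x3)]. *)
Lemma rtrans_conv f g x : rtrans g (rtrans f x) = rtrans (conv cU g f) x.
Proof.
rewrite /rtrans /= -tappr_tmap -tappr_assoc coprA.
elim/(@tens_ind K): (copr cU x) => [|a u v s ih]; first by rewrite !linear0.
rewrite !linearP ih !tmapE !tapprE convE; congr (_ *: (_ *: _) + _) => {s ih}.
elim/(@tens_ind K): (copr cU v) => [|b y z s ih]; first by rewrite !linear0.
rewrite !linearP ih tapprE tformE [g (_ *: y)]linearZ; congr (_ + _).
by congr (_ * _); exact: mulrC.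
Qed.

End Translations.

(** * Functoriality and multiplicativity of conjugation *)

Section ConjugationFunctoriality.
Context {K : fieldType} {U V : lmodType K} (cU : coalg U) (cV : coalg V).

Lemma ltrans_comor (h : {linear U -> V}) (f : {linear V -> K^o}) x :
  is_comor cU cV h -> h (ltrans cU (f \o h) x) = ltrans cV f (h x).
Proof.
move=> [hD _]; rewrite /ltrans /= hD.
elim/(@tens_ind K): (copr cU x) => [|a u v s ih]; first by rewrite !linear0.
by rewrite !linearP ih tmapE !tapplE linearZ.
Qed.

Lemma rtrans_comor (h : {linear U -> V}) (f : {linear V -> K^o}) x :
  is_comor cU cV h -> h (rtrans cU (f \o h) x) = rtrans cV f (h x).
Proof.
move=> [hD _]; rewrite /rtrans /= hD.
elim/(@tens_ind K): (copr cU x) => [|a u v s ih]; first by rewrite !linear0.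
by rewrite !linearP ih tmapE !tapprE linearZ.
Qed.

(** Taken with [h] a multiplication or an insertion of the unit, this is the
    equation characterising an inner coface or a codegeneracy. *)
Lemma conv_conj_pull (h : {linear U -> V}) (hP : is_comor cU cV h)
    (f : conv_unit cV) x :
  h (conv_conj (cu_pull hP f) x) = conv_conj f (h x).
Proof. by rewrite !conv_conjE rtrans_comor //= ltrans_comor. Qed.

Lemma ltrans_tens (f : {linear U -> K^o}) (g : {linear V -> K^o}) x :
  ltrans (tens_coalg cU cV) (tform f g) x = tmap (ltrans cU f) (ltrans cV g) x.
Proof.
apply: tens_ext x => u v; rewrite tmapE !ltransE copr_tensE.
elim/(@tens_ind K): (copr cU u) => [|a y z s ih].
  by rewrite !(linear0, tens0l).
rewrite !(linearP, tensPl) ih; congr (_ *: _ + _) => {s ih}.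
elim/(@tens_ind K): (copr cV v) => [|a' y' z' s ih].
  by rewrite !(linear0, tens0r).
rewrite !(linearP, tensPr) ih; congr (_ *: _ + _) => {s ih}.
by rewrite tmidE !tapplE tformE tensZl tensZr scalerA.
Qed.

Lemma rtrans_tens (f : {linear U -> K^o}) (g : {linear V -> K^o}) x :
  rtrans (tens_coalg cU cV) (tform f g) x = tmap (rtrans cU f) (rtrans cV g) x.
Proof.
apply: tens_ext x => u v; rewrite tmapE !rtransE copr_tensE.
elim/(@tens_ind K): (copr cU u) => [|a y z s ih].
  by rewrite !(linear0, tens0l).
rewrite !(linearP, tensPl) ih; congr (_ *: _ + _) => {s ih}.
elim/(@tens_ind K): (copr cV v) => [|a' y' z' s ih].
  by rewrite !(linear0, tens0r).
rewrite !(linearP, tensPr) ih; congr (_ *: _ + _) => {s ih}.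
by rewrite tmidE !tapprE tformE tensZl tensZr scalerA.
Qed.

(** Taken with one factor equal to the counit, this gives the outer
    cofaces. *)
Lemma conv_conj_tens (f : conv_unit cU) (g : conv_unit cV) x :
  conv_conj (cu_tens f g) x = tmap (conv_conj f) (conv_conj g) x.
Proof.
apply: tens_ext x => u v.
by rewrite tmapE !conv_conjE (ltrans_tens f g) (rtrans_tens (cu_inv f)) !tmapE.
Qed.

End ConjugationFunctoriality.

Section ConjugationGroup.
Context {K : fieldType} {U : lmodType K} (cU : coalg U).

(** The order is reversed because [rtrans (g^-1 * f^-1)] and [ltrans (f * g)]
    both let [f] act first; commuting the two actions regroups them into the
    two conjugations. *)
Lemma conv_conjM (f g : conv_unit cU) x :
  conv_conj (f * g)%g x = conv_conj g (conv_conj f x).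
Proof.
by rewrite !conv_conjE ltrans_rtransC rtrans_conv ltrans_conv.
Qed.

Lemma conv_conj1 x : conv_conj (1%g : conv_unit cU) x = x.
Proof. by rewrite conv_conjE /rtrans /ltrans /= counl counr. Qed.

Lemma conv_conjK (f : conv_unit cU) :
  cancel (conv_conj f) (conv_conj (cu_opp f)).
Proof. by move=> x; rewrite -conv_conjM -[RHS]conv_conj1 -(mulgV f). Qed.

Lemma conv_conjVK (f : conv_unit cU) :
  cancel (conv_conj (cu_opp f)) (conv_conj f).
Proof. exact: (conv_conjK (cu_opp f)). Qed.

End ConjugationGroup.

(** * Subspaces stable under conjugation *)

Section SpannedTensors.
Context {K : fieldType}.

(** The image of [S (x) T] in [U (x) V]; this is a set of tensors, so that [S]
    and [T] need not be turned into modules. *)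
Definition tspan (U V : lmodType K) (S : set U) (T : set V) : set (tensor U V) :=
  smallest (@is_subspace K (tensor U V))
    [set t | exists u v, [/\ S u, T v & t = tens u v]]%classic.

Lemma tspan_subspace (U V : lmodType K) (S : set U) (T : set V) :
  is_subspace (tspan S T).
Proof.
split=> [Q [[]]//|a u v gu gv Q QP]; apply: QP.1.2; [exact: gu|exact: gv].
Qed.

Lemma tspan_tens (U V : lmodType K) (S : set U) (T : set V) u v :
  S u -> T v -> tspan S T (tens u v).
Proof. by move=> Su Tv Q [_]; apply; exists u, v. Qed.

Lemma tspan_ind (U V W : lmodType K) (S : set U) (T : set V) (Q : set W)
    (f : {linear tensor U V -> W}) : is_subspace Q ->
  (forall u v, S u -> T v -> Q (f (tens u v))) ->
  forall t, tspan S T t -> Q (f t).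
Proof.
move=> Q0 Qf t tST.
apply: (tST [set s | Q (f s)]%classic); split; first exact: preim_subspace.
by move=> _ [u [v [Su Tv ->]]]; apply: Qf.
Qed.

Lemma tspan_ind2 (U V U' V' W : lmodType K) (S : set U) (T : set V)
    (S' : set U') (T' : set V') (Q : set W)
    (f : {linear tensor (tensor U V) (tensor U' V') -> W}) : is_subspace Q ->
  (forall u v u' v', S u -> T v -> S' u' -> T' v' ->
     Q (f (tens (tens u v) (tens u' v')))) ->
  forall s t, tspan S T s -> tspan S' T' t -> Q (f (tens s t)).
Proof.
move=> Q0 Qf s t Ss St.
apply: (tspan_ind (f := f \o tensl t) Q0 _ Ss) => u v Su Tv.
apply: (tspan_ind (f := f \o tensr (tens u v)) Q0 _ St) => u' v' Su' Tv'.
exact: Qf.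
Qed.

Lemma subspaceZ (U : lmodType K) (S : set U) a x :
  is_subspace S -> S x -> S (a *: x).
Proof.
by move=> [S0 SP] Sx; rewrite -[a *: x]addr0; apply: SP.
Qed.

(** The iterated coproduct of an element of [S] has its middle factor in [S],
    and that factor is all that conjugation keeps. *)
Lemma conv_conj_stable (U : lmodType K) (cU : coalg U) (S : set U)
    (f : conv_unit cU) :
  is_subspace S -> (forall x, S x -> tspan S S (copr cU x)) ->
  forall x, S x -> S (conv_conj f x).
Proof.
move=> S0 SD x.
have lS y : S y -> S (ltrans cU f y).
  move/SD; apply: (tspan_ind (f := tappl U f) S0) => // u v _ Sv.
  by rewrite tapplE; apply: subspaceZ.
have rS y : S y -> S (rtrans cU (cu_inv f) y).
  move/SD; apply: (tspan_ind (f := tappr U (cu_inv f)) S0) => // u v Su _.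
  by rewrite tapprE; apply: subspaceZ.
by move=> Sx; rewrite conv_conjE; apply/rS/lS.
Qed.

End SpannedTensors.

(** * Conjugation on the tensor powers of the tensor algebra *)

Section TensorAlgebraConjugation.
Context {K : fieldType} {C : lmodType K} (c : coalg C).
Notation A := (talg C).

Definition words_of_size r : set A := [set word w | w in [set w | size w = r]]%classic.

(** On letters the coproduct is that of [C], hence of degree 1 in both factors,
    and degrees add up under the product of the tensor square. *)
Lemma copr_word_homog (w : seq C) :
  tspan (words_of_size (size w)) (words_of_size (size w))
    (copr (talg_bialg c) (word w)).
Proof.
rewrite /= wliftE; elim: w => [|v w ih] /=.
  by apply: tspan_tens; exists [::].
have letters s :
    tspan (words_of_size 1) (words_of_size 1) (tmap (@letter K C) (@letter K C) s).
  elim/(@tens_ind K): s => [|a x y s ihs].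
    by rewrite linear0; exact: (tspan_subspace _ _).1.
  rewrite linearP tmapE; apply: (tspan_subspace _ _).2 => //.
  by apply: tspan_tens; [exists [:: x]|exists [:: y]].
apply: (tspan_ind2 (tspan_subspace _ _) _ (letters _) ih).
move=> _ _ _ _ [x xr <-] [y yr <-] [w1 w1r <-] [w2 w2r <-].
rewrite tmul2E !wordM; apply: tspan_tens.
  by exists (x ++ w1) => //=; rewrite size_cat xr w1r.
by exists (y ++ w2) => //=; rewrite size_cat yr w2r.
Qed.

Lemma copr_graded n R x : @tgraded K C n R x ->
  tspan (@tgraded K C n R) (@tgraded K C n R) (copr (pow_coalg (talg_bialg c) n) x).
Proof.
apply: (tgraded_ind (preim_subspace _ (tspan_subspace _ _))) => w wR /=.
elim: n R w wR {x} => [|n ih] R w wR.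
  by apply: tspan_tens; apply: (tgraded_gen (w := w)).
rewrite [X in tspan _ _ X]copr_tensE.
have /= {}ih := ih _ _ (fun i => wR i.+1).
apply: (tspan_ind2 (tspan_subspace _ _) _ (@copr_word_homog (w 0%N)) ih).
move=> _ _ u v [w1 w1r <-] [w2 w2r <-] Ru Rv; rewrite tmidE.
by apply: tspan_tens; apply: tgraded_cons; rewrite ?w1r ?w2r ?wR.
Qed.

Lemma conv_conj_graded n (psi : convG (talg_bialg c) n) R x :
  @tgraded K C n R x -> @tgraded K C n R (conv_conj psi x).
Proof.
exact: (conv_conj_stable psi (@tgraded_subspace K C n R) (@copr_graded n R)).
Qed.

Definition conj_gaut n (psi : convG (talg_bialg c) n) : gaut C n :=
  GAut (conv_conjK psi) (conv_conjVK psi)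
    (graded_image (conv_conjVK psi) (conv_conj_graded psi)
       (conv_conj_graded (psi^-1)%g)).

Lemma conj_gautM n (psi phi : convG (talg_bialg c) n) :
  conj_gaut (psi * phi)%g = (conj_gaut phi * conj_gaut psi)%g.
Proof. by apply: gaut_ext => x; exact: conv_conjM. Qed.

Lemma conj_gaut1 n : conj_gaut (1%g : convG (talg_bialg c) n) = 1%g.
Proof. by apply: gaut_ext => x; exact: conv_conj1. Qed.

Lemma conj_gautV n (psi : convG (talg_bialg c) n) :
  conj_gaut (psi^-1)%g = ((conj_gaut psi)^-1)%g.
Proof. exact: gaut_ext. Qed.

Lemma conj_gaut_prod n (r : seq nat) (P : pred nat)
    (psi : nat -> convG (talg_bialg c) n) :
  conj_gaut (\big[*%g/1%g]_(i <- r | P i) psi i) =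
  (\big[*%g/1%g]_(i <- rev r | P i) conj_gaut (psi i))%g.
Proof.
elim: r => [|i r ih]; first by rewrite !big_nil conj_gaut1.
rewrite big_cons rev_cons -cats1 big_cat big_cons big_nil /= -ih.
by case: ifP => _; rewrite mulg1 // conj_gautM.
Qed.

(** The counit of the tensor algebra, applied to the inserted factor, is a left
    inverse. *)
Lemma unitat_inj n j : injective (unitat A n j).
Proof.
have tensr1K (U : lmodType K) : cancel (@tensr K A U 1) (tappl U (talg_coun c)).
  by move=> x; rewrite tapplE talg_coun1 scale1r.
suff [r rK] : exists r : {linear tpow A n.+1 -> tpow A n},
    cancel (unitat A n j) r by exact: can_inj rK.
elim: n j => [|n ih] [|j]; try by exists (tappl _ (talg_coun c)); exact: tensr1K.
by have [r rK] := ih j; exists (tmap idfun r); exact: tmap_idK.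
Qed.

(** Commuting with the outer cofaces is a computation; for the inner ones the
    conjugation is a solution of the equation that defines the coface, and
    that solution is unique. *)
Lemma conj_gaut_coface n i (psi : convG (talg_bialg c) n) : (i <= n.+1)%N ->
  conj_gaut (convG_coface i psi) = gaut_coface i (conj_gaut psi).
Proof.
rewrite /convG_coface /gaut_coface; case: eqP => [_ _|/eqP i0].
  apply: gaut_ext => x; apply: etrans (conv_conj_tens _ _ x) _.
  by apply: tens_ext x => u v; rewrite !tmapE conv_conj1.
case: eqP => [_ _|/eqP ni].
  apply: gaut_ext => x; apply: (can_inj (@tunsnocK K A n)).
  apply: etrans (conv_conj_pull _ _ x) _; apply/esym/(etrans (tsnocK _)).
  rewrite conv_conj_tens; apply: tens_ext (tunsnoc A n x) => u v.
  by rewrite !tmapE conv_conj1.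
(* For n = 0 both cofaces are outer ones. *)
case: n psi i0 ni => [|n] psi; first by case: i => [|[]].
move=> _ _ _; apply/esym/xget_unique => [x|t tP].
  exact: conv_conj_pull.
apply: (@gaut_coface_unique _ _ n i.-1 (conj_gaut psi)) => // x.
exact: conv_conj_pull.
Qed.

Lemma conj_gaut_codeg n i (psi : convG (talg_bialg c) n.+1) :
  conj_gaut (convG_codeg i psi) = gaut_codeg i (conj_gaut psi).
Proof.
apply/esym/xget_unique => [x|t tP]; first exact: conv_conj_pull.
by apply: gaut_ext => x; apply: (@unitat_inj n i); rewrite tP conv_conj_pull.
Qed.

(** The first factor of one coboundary becomes the last factor of the other one;
    the reversal of the order of the products does the rest. *)
Lemma conj_gaut_cobound n (psi : convG (talg_bialg c) n) :
  conj_gaut (convG_cobound psi) = gaut_cobound (conj_gaut psi).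
Proof.
rewrite conj_gautM conj_gautV !conj_gaut_prod revK /gaut_cobound.
have cofaceE (i : nat) : i \in iota 0 n.+2 ->
    conj_gaut (convG_coface i psi) = gaut_coface i (conj_gaut psi).
  by rewrite mem_iota => lti; apply: conj_gaut_coface.
congr (_ * _^-1)%g; rewrite [LHS]big_seq_cond [RHS]big_seq_cond;
  apply: eq_bigr => i /andP[]; rewrite ?mem_rev => /cofaceE //.
Qed.

End TensorAlgebraConjugation.

Theorem theorem6 (K : fieldType) (hK : real_or_complex K)
    (C : lmodType K) (c : coalg C) :
  exists F : forall n, convG (talg_bialg c) n -> gaut C n,
    [/\ forall n (psi : convG (talg_bialg c) n) x,
          F n psi x = conv_conj psi x,
        forall n (psi phi : convG (talg_bialg c) n),
          F n (psi * phi)%g = (F n phi * F n psi)%g,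
        (forall n i (psi : convG (talg_bialg c) n), (i <= n.+1)%N ->
          F n.+1 (convG_coface i psi) = gaut_coface i (F n psi)) /\
        (forall n i (psi : convG (talg_bialg c) n.+1), (i <= n)%N ->
          F n (convG_codeg i psi) = gaut_codeg i (F n.+1 psi))
      & is_qc_hom (X := convG_qc (talg_bialg c)) (Y := gaut_qc C) F].
Proof.
exists (@conj_gaut K C c); split=> //.
- exact: conj_gautM.
- split=> n i psi lti; [exact: conj_gaut_coface|exact: conj_gaut_codeg].
- by split=> n; [exact: conj_gaut1|exact: conj_gaut_cobound].
Qed.
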